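(* Let $n\ge3$. For any pair $(\Gamma,\Gamma')$ of triangulations of the reference $n$-gon there is a piecewise-linear automorphism $$T_{\Gamma,\Gamma'}:\mathbb R^{2n-4}\to\mathbb R^{2n-4}$$ of the affine space such that $T_{\Gamma,\Gamma'}(\Delta_{\Gamma'})=\Delta_\Gamma$. The map $T_{\Gamma,\Gamma'}$ is defined over $\mathbb Z$ if $\Delta_\Gamma$ is an integral polytope.
   Context: Fix $|r|>0$ (the sum of positive reals $r_1,\dots,r_n$ with $r_i<\sum_{j\ne i}r_j$). The reference polygon $P$ is a convex planar $n$-gon with sides $e_1,\dots,e_n$ in cyclic order. A triangulation $\Gamma$ of $P$ is given by $n-3$ pairwise non-crossing diagonals $d_1,\dots,d_{n-3}$; for each $\alpha$, $I_\alpha\subset\{1,\dots,n\}$ is the set of indices of the sides lying on one (chosen) side of $d_\alpha$. Let $(u_{e_1},\dots,u_{e_{n-1}},u_{d_1},\dots,u_{d_{n-3}})$ be the coordinates on $\mathbb R^{2n-4}$ attached to $\Gamma$, put $u_{e_n}=2|r|-\sum_{i=1}^{n-1}u_{e_i}$, and define length coordinates $$u(e_i)=\tfrac12u_{e_i}\ (1\le i\le n-1),\quad u(e_n)=|r|-\tfrac12\sum_{i=1}^{n-1}u_{e_i},\quad u(d_\alpha)=-u_{d_\alpha}+\tfrac12\sum_{i\in I_\alpha}u_{e_i}.$$ $\Delta_\Gamma\subset\mathbb R^{2n-4}$ is the polytope defined by the triangle inequalities $|u(a)-u(b)|\le u(c)\le u(a)+u(b)$ for every triangle of $\Gamma$ with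 edges $a,b,c\in\{e_1,\dots,e_n,d_1,\dots,d_{n-3}\}$. (It is the image of the integrable system $\Psi_\Gamma$ on $\mathrm{Gr}(2,n)$, and the moment polytope of the toric variety $X_\Gamma$.) A polytope is integral if its vertices lie in the lattice $\mathbb Z^{2n-4}$ of the coordinates $(u_{e_i},u_{d_\alpha})$. A piecewise-linear automorphism is a bijection that is continuous and affine-linear on each of finitely many polyhedral pieces (with the same property for the inverse); it is defined over $\mathbb Z$ if on each piece it is given, in the coordinates $(u_{e_i},u_{d_\alpha})$ of source and target, by affine functions with integer coefficients. *)

(* Defs.v *)
From HB Require Import structures.
From mathcomp Require Import all_boot all_order all_algebra.
From mathcomp Require Import all_classical all_reals all_analysis.

Set Implicit Arguments.
Unset Strict Implicit.
Unset Printing Implicit Defensive.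
Import Order.TTheory GRing.Theory Num.Theory.
Import numFieldNormedType.Exports.
Local Open Scope ring_scope.

(* The vertices of the n-gon are labelled cyclically by 'I_n and the side
   e_(i+1) is the segment from vertex i to vertex i + 1 mod n, so that e_n is
   the side with index n - 1.  A diagonal is recorded by its endpoints in
   increasing order. *)
Definition is_diagonal (n : nat) (d : 'I_n * 'I_n) : bool :=
  [&& (d.1 < d.2)%N, d.2 != ordS d.1 & d.1 != ordS d.2].

(* In a convex polygon, two diagonals meet in their interiors exactly when
   their endpoints interleave around the boundary. *)
Definition crossing (n : nat) (c d : 'I_n * 'I_n) : bool :=
  ((c.1 < d.1)%N && (d.1 < c.2)%N && (c.2 < d.2)%N) ||
  ((d.1 < c.1)%N && (c.1 < d.2)%N && (d.2 < c.2)%N).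

Record triangulation (n : nat) : Type := Triangulation {
  diag : 'I_(n - 3) -> 'I_n * 'I_n;
  diagP : forall a, is_diagonal (diag a);
  diag_inj : injective diag;
  diag_noncrossing : forall a b, ~~ crossing (diag a) (diag b)
}.

Definition side_arc (n : nat) (d : 'I_n * 'I_n) : {set 'I_n} :=
  [set k : 'I_n | (d.1 <= k)%N && (k < d.2)%N]%SET.

(* I a is the set of sides lying on one of the two sides of diag G a. *)
Definition side_choice (n : nat) (G : triangulation n)
    (I : 'I_(n - 3) -> {set 'I_n}) : Prop :=
  forall a, I a = side_arc (diag G a) \/ I a = (~: side_arc (diag G a))%SET.

(* inl i is the side with index i, inr a the diagonal with index a. *)
Definition edge (n : nat) : Type := ('I_n + 'I_(n - 3))%type.

Definition ends (n : nat) (G : triangulation n) (e : edge n) : {set 'I_n} :=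
  match e with
  | inl i => [set i; ordS i]%SET
  | inr a => [set (diag G a).1; (diag G a).2]%SET
  end.

Definition is_triangle (n : nat) (G : triangulation n) (a b c : edge n) : Prop :=
  exists x y z : 'I_n,
    [/\ uniq [:: x; y; z], ends G a = [set x; y]%SET,
        ends G b = [set y; z]%SET & ends G c = [set z; x]%SET].

(* Points of R^(2n-4) are row vectors (u_(e_1), ..., u_(e_(n-1))) followed by
   (u_(d_1), ..., u_(d_(n-3))); n.-1 + (n - 3) is 2n - 4 when n >= 3.
   The parameter rho is |r|. *)
Section LengthCoordinates.
Variables (R : realType) (n : nat) (rho : R).
Implicit Type u : 'rV[R]_(n.-1 + (n - 3)).

(* For the last side, insub fails and u_(e_n) is the dependent coordinate. *)
Definition u_side u (i : 'I_n) : R :=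
  if insub (val i) is Some j then u 0 (lshift (n - 3) (j : 'I_n.-1))
  else 2 * rho - \sum_(j < n.-1) u 0 (lshift (n - 3) j).

Definition u_diag u (a : 'I_(n - 3)) : R := u 0 (rshift n.-1 a).

Definition len (I : 'I_(n - 3) -> {set 'I_n}) u (e : edge n) : R :=
  match e with
  | inl i => 2^-1 * u_side u i
  | inr a => - u_diag u a + 2^-1 * \sum_(i in I a) u_side u i
  end.

Definition Delta (G : triangulation n) (I : 'I_(n - 3) -> {set 'I_n}) :
    set 'rV[R]_(n.-1 + (n - 3)) :=
  [set u | forall a b c, is_triangle G a b c ->
     `|len I u a - len I u b| <= len I u c <= len I u a + len I u b]%classic.

End LengthCoordinates.

Section PolyhedralGeometry.
Variables (R : realType) (N : nat).
Implicit Types (P : set 'rV[R]_N) (T : 'rV[R]_N -> 'rV[R]_N).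

Definition polyhedron P : Prop :=
  exists (m : nat) (A : 'M[R]_(N, m)) (b : 'rV[R]_m),
    P = [set x | forall j, (x *m A) 0 j <= b 0 j]%classic.

(* A vertex is a zero-dimensional face: the unique maximiser on P of some
   linear functional. *)
Definition vertex P (v : 'rV[R]_N) : Prop :=
  P v /\ exists c : 'cV[R]_N,
    forall x, P x -> x != v -> (x *m c) 0 0 < (v *m c) 0 0.

Definition integral_polytope P : Prop :=
  forall v, vertex P v -> v \is a mxOver Num.int.

Definition piecewise_affine_over (S : {pred R}) T : Prop :=
  exists (k : nat) (Q : 'I_k -> set 'rV[R]_N),
    [/\ forall i, polyhedron (Q i),
        forall x, exists i, Q i x &
        forall i, exists (A : 'M[R]_N) (b : 'rV[R]_N),
          [/\ A \is a mxOver S, b \is a mxOver S &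
              forall x, Q i x -> T x = x *m A + b]].

Definition pl_automorphism T : Prop :=
  exists T' : 'rV[R]_N -> 'rV[R]_N,
    [/\ cancel T T', cancel T' T,
        continuous T /\ piecewise_affine_over predT T &
        continuous T' /\ piecewise_affine_over predT T'].

Definition defined_over_Z T : Prop := piecewise_affine_over Num.int T.

End PolyhedralGeometry.

(* Main.v *)
Require Import Defs.
From HB Require Import structures.
From mathcomp Require Import all_boot all_order all_algebra fingroup perm.
From mathcomp Require Import all_classical all_reals all_analysis.
From mathcomp Require Import ring lra zify.
Set Implicit Arguments.
Unset Strict Implicit.
Unset Printing Implicit Defensive.
Import Order.TTheory GRing.Theory Num.Theory.
Import numFieldNormedType.Exports.
Local Open Scope ring_scope.

(* A triangulation of the n-gon is a binary tree rooted at the closing side, and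
   Delta_Gamma is the set of length assignments satisfying the triangle
   inequality at every node.  A rotation of the tree is a flip of the
   triangulation inside a quadrilateral with sides A, B, C, X; the admissible
   interval [m, M] of the old diagonal and [m', M'] of the new one have the same
   length, so l |-> l - m + m' exchanges the two polytopes.  As each length is
   half the sum of the u_(e_i) it cuts off, up to an affine form over Z[rho],
   this is a shear in one coordinate by a piecewise linear function over Z[rho].
   Rotations bring every tree to a right comb, and two combs differ by a
   renumbering of the diagonals.  Finally rho = |r| is a coordinate of the vertex
   at which all edges but the two sides of an ear degenerate, so Z[rho] = Z when
   Delta_Gamma is integral. *)

(** The factors 1/2 are the obstacle: lengths are not integral in the coordinates, so the
    integrality of a flip needs an argument. Let h be half the sum of the [u_(e_i)] that an edge
    cuts off, so that the diagonal b has u_b = h - l. In these coordinates the lower ends enter only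
    as m - h_AB and m' - h_BC. Modulo affine forms over Z[rho] each length equals its own h, the
    sign of h is irrelevant because 2h is integral, and h_X = h_A + h_B + h_C; so every entry of the
    two maxima is integral. The closing side has length rho - h, which brings rho into the
    coefficients. A second obstacle is that a triangulation is given only as n - 3 distinct
    non-crossing diagonals, without its triangles. The tree comes from an extremal count: at most j
    - i - 2 diagonals lie under the chord (i, j), itself excluded, and equality is inherited by the
    two chords from i and j to a suitable apex. *)

Section Polyhedra.
Variables (R : realType) (N : nat).
Implicit Types (P Q : set 'rV[R]_N) (f g : 'rV[R]_N -> R).

Lemma polyhedronI P Q : polyhedron P -> polyhedron Q -> polyhedron (P `&` Q)%classic.
Proof.
move=> [m [A [b ->]]] [k [C [d ->]]].
exists (m + k)%N, (row_mx A C), (row_mx b d).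
apply/seteqP; split=> x /=.
  move=> [hA hC] j; rewrite mul_mx_row !mxE; case: (fintype.split j) => i; first exact: hA.
  exact: hC.
move=> h; split=> j.
  by have := h (lshift k j); rewrite mul_mx_row !row_mxEl.
by have := h (rshift m j); rewrite mul_mx_row !row_mxEr.
Qed.

Lemma polyhedron_preim P (A : 'M[R]_N) (b : 'rV[R]_N) :
  polyhedron P -> polyhedron [set x | P (x *m A + b)]%classic.
Proof.
move=> [m [C [d ->]]]; exists m, (A *m C), (d - b *m C).
apply/seteqP; split=> x /= h j; have := h j;
  by rewrite mulmxDl mulmxA !mxE lerBrDr.
Qed.

Definition affine_form (S : {pred R}) f : Prop :=
  exists (c : 'cV[R]_N) (d : R),
    [/\ c \is a mxOver S, d \in S & forall u, f u = (u *m c) 0 0 + d].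

Lemma polyhedron_le (S1 S2 : {pred R}) f g :
  affine_form S1 f -> affine_form S2 g -> polyhedron [set u | f u <= g u]%classic.
Proof.
move=> [c [d [_ _ fE]]] [c' [d' [_ _ gE]]].
exists 1%N, (c - c'), (\row__ (d' - d)); apply/seteqP; split=> u /=.
  move=> + j; rewrite ord1 fE gE mulmxBr !mxE => h; lra.
move=> /(_ 0); rewrite fE gE mulmxBr !mxE => h; lra.
Qed.

Lemma polyhedronT : polyhedron [set: 'rV[R]_N]%classic.
Proof.
exists 0%N, 0, 0; apply/seteqP; split=> u //= _ [] //.
Qed.

End Polyhedra.

(** * Affine forms with coefficients in a subring *)

Section AffineForms.
Variables (R : realType) (N : nat) (S : subringClosed R).
Implicit Types f g : 'rV[R]_N -> R.

Lemma affine_form_cst (d : R) : d \in S -> @affine_form R N S (fun=> d).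
Proof.
move=> dS; exists 0, d; split=> //; first exact: rpred0.
by move=> u; rewrite mulmx0 mxE add0r.
Qed.

Lemma affine_form_coord j : affine_form S (fun u : 'rV[R]_N => u 0 j).
Proof.
exists (delta_mx j 0), 0; split; rewrite ?rpred0 //.
  by apply/mxOverP => i k; rewrite mxE rpred_nat.
by move=> u; rewrite -colE mxE addr0.
Qed.

Lemma affine_formD f g :
  affine_form S f -> affine_form S g -> affine_form S (fun u => f u + g u).
Proof.
move=> [c [d [cS dS fE]]] [c' [d' [cS' dS' gE]]].
exists (c + c'), (d + d'); split; rewrite ?rpredD // => u.
rewrite fE gE mulmxDr !mxE; ring.
Qed.

Lemma affine_formN f : affine_form S f -> affine_form S (fun u => - f u).
Proof.
move=> [c [d [cS dS fE]]].
exists (- c), (- d); split; rewrite ?rpredN // => u.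
by rewrite fE mulmxN !mxE opprD.
Qed.

Lemma affine_formB f g :
  affine_form S f -> affine_form S g -> affine_form S (fun u => f u - g u).
Proof. by move=> hf hg; apply: affine_formD => //; apply: affine_formN. Qed.

Lemma affine_form_sum (J : Type) (s : seq J) (P : pred J) (F : J -> 'rV[R]_N -> R) :
  (forall j, affine_form S (F j)) ->
  affine_form S (fun u => \sum_(j <- s | P j) F j u).
Proof.
move=> hF; elim: s => [|j s IH].
  have [c [d [h1 h2 h3]]] := affine_form_cst (rpred0 S).
  by exists c, d; split=> // u; rewrite big_nil -h3.
have [c [d [h1 h2 h3]]] : affine_form S
    (fun u => if P j then F j u + \sum_(j <- s | P j) F j u
              else \sum_(j <- s | P j) F j u).
  by case: (P j) => //; apply: affine_formD.
by exists c, d; split=> // u; rewrite big_cons -h3.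
Qed.

End AffineForms.

(** * Piecewise affine functions and maps *)

Section PiecewiseAffine.
Variables (R : realType) (N : nat).
Implicit Types (f g : 'rV[R]_N -> R) (T : 'rV[R]_N -> 'rV[R]_N).

(** Pieces are indexed by any finite type, so that common refinements are indexed by products;
    [piecewise_affine_fin] returns to ordinals. *)
Definition pl_function (S : {pred R}) g : Prop :=
  exists (J : finType) (Q : J -> set 'rV[R]_N),
    [/\ forall i, polyhedron (Q i), forall x, exists i, Q i x &
        forall i, exists2 f, affine_form S f & forall x, Q i x -> g x = f x].

Lemma pl_function_affine (S : {pred R}) f : affine_form S f -> pl_function S f.
Proof.
move=> hf; exists unit, (fun=> setT); split=> //; first by move=> _; exact: polyhedronT.
by move=> _; exists f.
Qed.

Lemma pl_function_max (S : {pred R}) f g :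
  pl_function S f -> pl_function S g ->
  pl_function S (fun u => Num.max (f u) (g u)).
Proof.
move=> [J [Q [hQ cQ aQ]]] [K [W [hW cW aW]]].
pose V (i : J * K * bool) :=
  (Q i.1.1 `&` W i.1.2 `&` [set u | if i.2 then f u <= g u else g u <= f u])%classic.
exists [the finType of (J * K * bool)%type], V; split.
- move=> [[i j] b]; have [f' hf' ff'] := aQ i; have [g' hg' gg'] := aW j.
  (* On [Q i] and [W j] the comparison of [f] with [g] is one between affine forms, hence a
     half-space. *)
  have -> : V (i, j, b) = (Q i `&` W j `&`
      [set u | if b then f' u <= g' u else g' u <= f' u])%classic.
    by apply/seteqP; split=> u [[h1 h2]]; rewrite /V /= ?ff' ?gg'.
  apply: polyhedronI; first exact: polyhedronI.
  by case: b; apply: polyhedron_le; eassumption.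
- move=> x; have [i hi] := cQ x; have [j hj] := cW x.
  by case: (leP (f x) (g x)) => [h|/ltW h]; [exists (i, j, true) | exists (i, j, false)].
move=> [[i j] []].
  have [g' hg' gg'] := aW j; exists g' => // x [[_ h2]] /= h3.
  by rewrite max_r // gg'.
have [f' hf' ff'] := aQ i; exists f' => // x [[h1 _]] /= h3.
by rewrite max_l // ff'.
Qed.

Lemma pl_functionB (S : subringClosed R) f g :
  pl_function S f -> pl_function S g -> pl_function S (fun u => f u - g u).
Proof.
move=> [J [Q [hQ cQ aQ]]] [K [W [hW cW aW]]].
exists [the finType of (J * K)%type], (fun i => Q i.1 `&` W i.2)%classic; split.
- by move=> [i j]; apply: polyhedronI.
- by move=> x; have [i hi] := cQ x; have [j hj] := cW x; exists (i, j).
move=> [i j]; have [f' hf' ff'] := aQ i; have [g' hg' gg'] := aW j.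
by exists (fun u => f' u - g' u); [apply: affine_formB | move=> x [/= h1 h2]; rewrite ff' // gg'].
Qed.

Lemma piecewise_affine_fin (S : {pred R}) (J : finType) (Q : J -> set 'rV[R]_N) T :
  (forall i, polyhedron (Q i)) -> (forall x, exists i, Q i x) ->
  (forall i, exists (A : 'M[R]_N) (b : 'rV[R]_N),
     [/\ A \is a mxOver S, b \is a mxOver S & forall x, Q i x -> T x = x *m A + b]) ->
  piecewise_affine_over S T.
Proof.
move=> h1 h2 h3; exists #|J|, (fun i => Q (enum_val i)); split=> //.
by move=> x; have [j hj] := h2 x; exists (enum_rank j); rewrite enum_rankK.
Qed.

Lemma piecewise_affine_comp (S : subringClosed R) T1 T2 :
  piecewise_affine_over S T1 -> piecewise_affine_over S T2 ->
  piecewise_affine_over S (T2 \o T1).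
Proof.
move=> [k [Q [hQ cQ aQ]]] [m [W [hW cW aW]]].
apply: (@piecewise_affine_fin S [the finType of ('I_k * 'I_m)%type]
  (fun i => Q i.1 `&` [set x | W i.2 (T1 x)])%classic).
- move=> [i j] /=; have [A [b [_ _ h]]] := aQ i.
  (* The preimage of [W j] under [T1] need not be polyhedral, but on [Q i] it is the preimage under
     one affine map. *)
  have -> : (Q i `&` [set x | W j (T1 x)] =
             Q i `&` [set x | W j (x *m A + b)])%classic.
    by apply/seteqP; split=> u /= [hi]; rewrite h.
  by apply: polyhedronI => //; apply: polyhedron_preim.
- by move=> x; have [i hi] := cQ x; have [j hj] := cW (T1 x); exists (i, j).
move=> [i j]; have [A [b [AS bS h]]] := aQ i; have [A' [b' [AS' bS' h']]] := aW j.
exists (A *m A'), (b *m A' + b'); split.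
- exact: mxOverM.
- exact: rpredD (mxOverM bS AS') bS'.
by move=> x /= [hi hj]; rewrite h' // h // mulmxDl mulmxA addrA.
Qed.

Lemma affine_form_continuous (S : {pred R}) f : affine_form S f -> continuous f.
Proof.
move=> [c [d [_ _ fE]]].
have -> : f = fun u : 'rV[R]_N => \sum_j u 0 j * c j 0 + d.
  by apply/funext => u; rewrite fE mxE.
suff hs (s : seq 'I_N) (u : 'rV[R]_N) :
    (\sum_(j <- s) v 0 j * c j 0 @[v --> u] --> \sum_(j <- s) u 0 j * c j 0)%classic.
  by move=> u; apply: cvgD (hs _ u) (cvg_cst _).
elim: s => [|j s IH].
  by under eq_cvg do rewrite big_nil; rewrite big_nil; exact: cvg_cst.
under eq_cvg do rewrite big_cons; rewrite big_cons.
by apply: cvgD IH; apply: cvgM; [exact: coord_continuous | exact: cvg_cst].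
Qed.

End PiecewiseAffine.

(** * Invertible piecewise linear maps over every subring containing rho *)

Section IntegralPLMaps.
Variables (R : realType) (N : nat) (rho : R).
Implicit Types (T : 'rV[R]_N -> 'rV[R]_N) (g : 'rV[R]_N -> R).

(* Quantifying over all subrings containing rho rather than fixing Z[rho]
   gives both the real and, once rho is known to be an integer, the integral
   structure. *)
Definition pl_automorphism_with T T' : Prop :=
  [/\ cancel T T', cancel T' T, continuous T, continuous T' &
      forall S : subringClosed R, rho \in S ->
        piecewise_affine_over S T /\ piecewise_affine_over S T'].

Definition rho_pl T : Prop := exists T', pl_automorphism_with T T'.

Lemma piecewise_affine_affine (S : {pred R}) (A : 'M[R]_N) (b : 'rV[R]_N) :
  A \is a mxOver S -> b \is a mxOver S ->
  piecewise_affine_over S (fun u => u *m A + b).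
Proof.
move=> AS bS; exists 1%N, (fun=> setT); split.
- by move=> _; exact: polyhedronT.
- by move=> x; exists 0.
- by move=> _; exists A, b.
Qed.

Lemma rho_pl_id : rho_pl id.
Proof.
have h (S : subringClosed R) : piecewise_affine_over S (@id 'rV[R]_N).
  have -> : @id 'rV[R]_N = fun u => u *m 1%:M + 0.
    by apply/funext => u; rewrite mulmx1 addr0.
  by apply: piecewise_affine_affine; rewrite ?rpred0 ?mxOver_scalar ?rpred0 ?rpred1.
by exists id; split=> //; try exact: (fun x => cvg_id).
Qed.

Lemma rho_pl_comp T1 T2 : rho_pl T1 -> rho_pl T2 -> rho_pl (T2 \o T1).
Proof.
move=> [U1 [c1 d1 k1 l1 h1]] [U2 [c2 d2 k2 l2 h2]].
exists (U1 \o U2); split.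
- exact: can_comp.
- exact: can_comp.
- by move=> x; apply: continuous_comp; [exact: k1 | exact: k2].
- by move=> x; apply: continuous_comp; [exact: l2 | exact: l1].
by move=> S rS; have [? ?] := h1 S rS; have [? ?] := h2 S rS;
  split; apply: piecewise_affine_comp.
Qed.

Lemma pl_automorphism_with_sym T U : pl_automorphism_with T U -> pl_automorphism_with U T.
Proof. by case=> h1 h2 h3 h4 h5; split=> // S /h5[]. Qed.

Definition shear (b : 'I_N) g (u : 'rV[R]_N) : 'rV[R]_N := u + g u *: delta_mx 0 b.

Lemma piecewise_affine_shear (S : subringClosed R) b g :
  pl_function S g -> piecewise_affine_over S (shear b g).
Proof.
move=> [J [Q [hQ cQ aQ]]]; apply: (@piecewise_affine_fin _ _ _ J Q) => // i.
have [f [c [d [cS dS fE]]] gE] := aQ i.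
have dlS : delta_mx 0 b \is a @mxOver 1 N R S.
  by apply/mxOverP => j k; rewrite mxE rpred_nat.
exists (1%:M + c *m delta_mx 0 b), (d *: delta_mx 0 b); split.
- apply: rpredD; first by rewrite mxOver_scalar ?rpred0 ?rpred1.
  exact: mxOverM.
- exact: mxOverZ.
move=> u /gE; rewrite /shear => ->; rewrite fE mulmxDr mulmx1 mulmxA.
by rewrite [u *m c]mx11_scalar mul_scalar_mx scalerDl !mxE eqxx mulr1n addrA.
Qed.

Lemma continuous_shear b g : continuous g -> continuous (shear b g).
Proof.
move=> cg u; apply: (@cvgD R 'rV[R]_N _ (nbhs u) _ id); first exact: cvg_id.
by apply: cvgZ (cg u) (cvg_cst _).
Qed.

(** As [g] ignores the coordinate [b] that is moved, the shear by [- g] is the inverse. *)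
Lemma rho_pl_shear b g :
  (forall u t, g (u + t *: delta_mx 0 b) = g u) -> continuous g ->
  (forall S : subringClosed R, rho \in S -> pl_function S g) ->
  rho_pl (shear b g).
Proof.
move=> gb cg hg; exists (shear b (fun u => - g u)).
have cg' : continuous (fun u => - g u) by move=> u; exact: cvgN (cg u).
split.
- by move=> u; rewrite /shear gb scaleNr addrK.
- by move=> u; rewrite /shear gb scaleNr subrK.
- exact: continuous_shear.
- exact: continuous_shear.
move=> S rS; split; apply: piecewise_affine_shear; first exact: hg.
have -> : (fun u => - g u) = fun u => 0 - g u by apply/funext => u; rewrite sub0r.
apply: pl_functionB; last exact: hg.
by apply: pl_function_affine; apply: affine_form_cst; rewrite rpred0.
Qed.

Lemma continuous_mulmxr (A : 'M[R]_N) : continuous (fun u : 'rV[R]_N => u *m A).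
Proof.
have -> : (fun u : 'rV[R]_N => u *m A) = fun u => \sum_j u 0 j *: row j A.
  by apply/funext => u; rewrite mulmx_sum_row.
suff hs (s : seq 'I_N) : continuous (fun v : 'rV[R]_N => \sum_(j <- s) v 0 j *: row j A).
  exact: hs.
elim: s => [|j s IH].
  have -> : (fun v : 'rV[R]_N => \sum_(j <- [::]) v 0 j *: row j A) = fun=> 0.
    by apply/funext => v; rewrite big_nil.
  exact: (@cst_continuous 'rV[R]_N 'rV[R]_N 0).
have -> : (fun v : 'rV[R]_N => \sum_(i <- j :: s) v 0 i *: row i A) =
    fun v => v 0 j *: row j A + \sum_(i <- s) v 0 i *: row i A.
  by apply/funext => v; rewrite big_cons.
move=> v; apply: cvgD (IH v).
exact: cvgZ (@coord_continuous R 1 N 0 j v) (cvg_cst _).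
Qed.

Lemma rho_pl_perm (s : {perm 'I_N}) : rho_pl (col_perm s).
Proof.
have pE (p : {perm 'I_N}) : @col_perm R 1 N p = fun u => u *m perm_mx p^-1.
  by apply/funext => u; rewrite col_permE.
have hS (S : subringClosed R) (p : {perm 'I_N}) :
    piecewise_affine_over S (@col_perm R 1 N p).
  have -> : @col_perm R 1 N p = fun u => u *m perm_mx p^-1 + 0.
    by rewrite pE; apply/funext => u; rewrite addr0.
  apply: piecewise_affine_affine; last by rewrite rpred0.
  by apply/mxOverP => j k; rewrite !mxE rpred_nat.
exists (col_perm s^-1); split=> //.
- by move=> u; rewrite -col_permM mulVg col_perm1.
- by move=> u; rewrite -col_permM mulgV col_perm1.
- by rewrite pE; exact: continuous_mulmxr.
- by rewrite pE; exact: continuous_mulmxr.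
Qed.

End IntegralPLMaps.

(** * Triangle inequalities in a quadrilateral *)

Definition triangle_ineq (R : realType) (x y z : R) : bool := `|x - y| <= z <= x + y.

(** Used for the lower end of the admissible interval of a diagonal: each of its two triangles
    contributes two lower bounds. *)
Definition max4 (R : realType) (a b c d : R) : R := Num.max (Num.max a b) (Num.max c d).

Lemma max4B (R : realType) (a b c d k : R) :
  max4 (a - k) (b - k) (c - k) (d - k) = max4 a b c d - k.
Proof. by rewrite /max4 -!addr_maxl. Qed.

Lemma max4_spec (R : realType) (a b c d : R) :
  [/\ a <= max4 a b c d, b <= max4 a b c d, c <= max4 a b c d, d <= max4 a b c d &
      max4 a b c d \in [:: a; b; c; d]].
Proof.
rewrite /max4 !le_max !lexx !orbT !inE; split=> //.
by rewrite /Order.max; do !case: ifP => _; rewrite eqxx ?orbT.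
Qed.

Lemma triangle_ineqP (R : realType) (x y z : R) :
  triangle_ineq x y z <-> [/\ x - y <= z, y - x <= z & z <= x + y].
Proof.
rewrite /triangle_ineq ler_norml; split; first by move=> /andP[/andP[? ?] ?]; split; lra.
by move=> [? ? ?]; apply/andP; split; [apply/andP; split|]; lra.
Qed.

(* The admissible interval for either diagonal of a quadrilateral with sides
   A, B, C, X has length min(2A, 2B, 2C, 2X, A+B+C-X, ...), which is symmetric
   in the sides; so translating one lower end to the other matches the two
   intervals. *)
Lemma quadrilateral_flip (R : realType) (A B C X l l' : R) :
  l' - max4 (B - C) (C - B) (A - X) (X - A) =
    l - max4 (A - B) (B - A) (X - C) (C - X) ->
  (triangle_ineq X l C /\ triangle_ineq l A B) <->
  (triangle_ineq X A l' /\ triangle_ineq l' B C).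
Proof.
rewrite !triangle_ineqP.
have [] := max4_spec (A - B) (B - A) (X - C) (C - X); move: (max4 _ _ _ _) => m.
have [] := max4_spec (B - C) (C - B) (A - X) (X - A); move: (max4 _ _ _ _) => m'.
rewrite !inE => m1' m2' m3' m4' em' m1 m2 m3 m4 em h.
split=> -[[h1 h2 h3] [h4 h5 h6]].
  have {em}lm : m <= l by case/or4P: em => /eqP->; lra.
  (* The lower bounds on [l'] follow from [m' <= l']. For the upper bounds one needs only which
     entry [m'] equals, the four lower bounds on [m] and the upper bounds on [l]. *)
  by case/or4P: em' => /eqP e'; split; split; lra.
have {em'}lm' : m' <= l' by case/or4P: em' => /eqP->; lra.
by case/or4P: em => /eqP e; split; split; lra.
Qed.

(** * Side and diagonal coordinates *)

Section Coordinates.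
Variables (R : realType) (n : nat) (rho : R).
Implicit Types (u v : 'rV[R]_(n.-1 + (n - 3))).

Lemma affine_form_u_side (S : subringClosed R) i :
  rho \in S -> affine_form S (fun u => u_side rho u i).
Proof.
move=> rS; rewrite /u_side; case: insubP => [j _ _|_]; first exact: affine_form_coord.
apply: affine_formB; last by apply: affine_form_sum => j; exact: affine_form_coord.
by apply: affine_form_cst; rewrite rpredM ?rpred_nat.
Qed.

Lemma affine_form_u_diag (S : subringClosed R) a :
  affine_form S (fun u => u_diag u a).
Proof. exact: affine_form_coord. Qed.

Lemma eq_u_side u v : (forall j, u 0 (lshift (n - 3) j) = v 0 (lshift (n - 3) j)) ->
  forall i, u_side rho u i = u_side rho v i.
Proof.
move=> h i; rewrite /u_side; case: insub => [j|]; first exact: h.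
by congr (_ - _); apply: eq_bigr => j _; exact: h.
Qed.

Lemma u_side_diag_shift u b t i :
  u_side rho (u + t *: delta_mx 0 (rshift n.-1 b)) i = u_side rho u i.
Proof.
apply: eq_u_side => j; rewrite !mxE eqxx /=.
by rewrite (negbTE (_ : lshift _ _ != rshift _ _)) ?mulr0 ?addr0 // eq_lrshift.
Qed.

Lemma u_diag_diag_shift u b t a :
  u_diag (u + t *: delta_mx 0 (rshift n.-1 b)) a = u_diag u a + (a == b)%:R * t.
Proof. by rewrite /u_diag !mxE eqxx /= (inj_eq (@rshift_inj _ _)) mulrC. Qed.

End Coordinates.

(** * Labelled binary trees and their triangle inequalities *)

Section Trees.
Variable n : nat.

(** A [Node] stands for a triangle: its label is the edge facing the root, and the tops of its
    subtrees are the other two edges. *)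
Inductive tree : Type := Leaf of 'I_n | Node of edge n & tree & tree.

Fixpoint leaves t : seq 'I_n :=
  match t with Leaf i => [:: i] | Node _ l r => leaves l ++ leaves r end.

Definition top t : edge n := match t with Leaf i => inl i | Node e _ _ => e end.

(** The top edge is left out: it is shared with the triangle above, and a flip below must not move
    its coordinate. *)
Fixpoint inner t : seq (edge n) :=
  match t with
  | Leaf _ => [::]
  | Node _ l r => (top l :: inner l) ++ (top r :: inner r)
  end.

Definition labels t := top t :: inner t.

(** Meant for proper subtrees; the root of the whole tree carries the closing side. *)
Fixpoint diag_nodes t : bool :=
  match t with
  | Leaf _ => true
  | Node e l r => [&& (if e is inr _ then true else false), diag_nodes l & diag_nodes r]
  end.

Variables (R : realType) (rho : R).
Implicit Types (u v : 'rV[R]_(n.-1 + (n - 3))).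

Definition half_perimeter u (s : seq 'I_n) : R := 2^-1 * \sum_(i <- s) u_side rho u i.

(** The sides cut off are read from the tree and not from a choice [I], so that rotations need no
    reference to a triangulation. *)
Definition edge_len u (e : edge n) (s : seq 'I_n) : R :=
  match e with
  | inl i => 2^-1 * u_side rho u i
  | inr a => - u_diag u a + half_perimeter u s
  end.

Definition tree_len u t : R := edge_len u (top t) (leaves t).

Fixpoint feasible t u : Prop :=
  match t with
  | Leaf _ => True
  | Node _ l r => [/\ triangle_ineq (tree_len u t) (tree_len u l) (tree_len u r),
                      feasible l u & feasible r u]
  end.

Definition same_sides u v := forall i, u_side rho u i = u_side rho v i.

Lemma half_perimeter_cat u s1 s2 :
  half_perimeter u (s1 ++ s2) = half_perimeter u s1 + half_perimeter u s2.
Proof. by rewrite /half_perimeter big_cat mulrDr. Qed.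

Lemma eq_half_perimeter u v s : same_sides u v -> half_perimeter u s = half_perimeter v s.
Proof. by move=> h; congr (_ * _); apply: eq_bigr => i _; exact: h. Qed.

Lemma eq_edge_len u v e s : same_sides u v ->
  (forall a, e = inr a -> u_diag u a = u_diag v a) -> edge_len u e s = edge_len v e s.
Proof.
by case: e => [i|a] h hd /=; [rewrite h | rewrite (hd a) // (eq_half_perimeter _ h)].
Qed.

Lemma eq_feasible t u v : same_sides u v ->
  (forall a, inr a \in labels t -> u_diag u a = u_diag v a) ->
  feasible t u -> feasible t v.
Proof.
elim: t => [//|e l IHl r IHr] hs hd [h1 h2 h3].
have hl a : inr a \in labels l -> u_diag u a = u_diag v a.
  by rewrite inE => ha; apply: hd; rewrite !inE /= mem_cat; case/orP: ha => ->; rewrite ?orbT.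
have hr a : inr a \in labels r -> u_diag u a = u_diag v a.
  by move=> ha; apply: hd; rewrite inE /= inE mem_cat ha !orbT.
split; [|exact: IHl|exact: IHr].
move: h1; rewrite /tree_len (@eq_edge_len u v _ _ hs); last first.
  by move=> a /= ea; apply: hd; rewrite inE /= -ea eqxx.
rewrite (@eq_edge_len u v (top l) _ hs); last first.
  by move=> a /= ea; apply: hl; rewrite inE /= -ea eqxx.
rewrite (@eq_edge_len u v (top r) _ hs) //.
by move=> a /= ea; apply: hr; rewrite inE /= -ea eqxx.
Qed.

(* Modulo integral affine forms, the length of an edge is half the sum of the
   u_side over the sides it cuts off. *)
Definition integral_edge (e : edge n) (s : seq 'I_n) : Prop :=
  forall S : subringClosed R, rho \in S ->
    affine_form S (fun u => edge_len u e s - half_perimeter u s).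

Lemma integral_edge_diag a s : integral_edge (inr a) s.
Proof.
move=> S rS; have := affine_formN (@affine_form_u_diag R n S a).
by congr affine_form; apply/funext => u /=; rewrite addrK.
Qed.

Lemma integral_edge_leaf i : integral_edge (inl i) [:: i].
Proof.
move=> S rS; have := affine_form_cst (n.-1 + (n - 3)) (rpred0 S).
by congr affine_form; apply/funext => u /=; rewrite /half_perimeter big_seq1 subrr.
Qed.

Lemma integral_edge_tree t : diag_nodes t -> integral_edge (top t) (leaves t).
Proof.
case: t => [i _|[i|a] l r] //=; [exact: integral_edge_leaf | move=> _; exact: integral_edge_diag].
Qed.

End Trees.

(** * Equivalence of trees under piecewise linear changes of diagonal lengths *)

Section FlipEquivalence.
Variables (n : nat) (R : realType) (rho : R).
Implicit Types (u v : 'rV[R]_(n.-1 + (n - 3))) (t l r A B C : tree n).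

(** Fixing all diagonals outside [inner t] is what lets transformations of disjoint subtrees be
    combined. *)
Definition flip_equiv t t' : Prop :=
  [/\ leaves t' = leaves t, top t' = top t, perm_eq (inner t') (inner t) &
      exists2 T, rho_pl rho T & forall u,
        [/\ same_sides rho (T u) u,
            forall a, inr a \notin inner t -> u_diag (T u) a = u_diag u a &
            feasible rho t' (T u) <-> feasible rho t u]].

Lemma same_sides_trans u v w : same_sides rho u v -> same_sides rho v w -> same_sides rho u w.
Proof. by move=> h h' i; rewrite h. Qed.

Lemma same_sides_sym u v : same_sides rho u v -> same_sides rho v u.
Proof. by move=> h i; rewrite h. Qed.

Lemma uniq_labels_Node x l r : uniq (labels (Node x l r)) ->
  [/\ uniq (labels l), uniq (labels r), x \notin labels l, x \notin labels r &
      forall e, e \in labels l -> e \notin labels r].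
Proof.
have -> : labels (Node x l r) = x :: labels l ++ labels r by [].
rewrite cons_uniq cat_uniq mem_cat negb_or.
move=> /andP[/andP[? ?] /and3P[? /hasPn h ?]]; split=> // e el.
by apply/negP => /h; rewrite /= el.
Qed.

Lemma flip_equiv_refl t : flip_equiv t t.
Proof. by split=> //; exists id => //; exact: rho_pl_id. Qed.

Lemma flip_equiv_trans t1 t2 t3 : flip_equiv t1 t2 -> flip_equiv t2 t3 -> flip_equiv t1 t3.
Proof.
move=> [l1 r1 p1 [T1 g1 h1]] [l2 r2 p2 [T2 g2 h2]]; split.
- by rewrite l2.
- by rewrite r2.
- exact: perm_trans p2 p1.
exists (T2 \o T1); first exact: rho_pl_comp.
move=> u; have [s1 d1 f1] := h1 u; have [s2 d2 f2] := h2 (T1 u); split.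
- exact: same_sides_trans s2 s1.
- by move=> a ha; rewrite /= d2 ?d1 // (perm_mem p1).
- by rewrite /= f2.
Qed.

Lemma tree_len_flip t t' u v : leaves t' = leaves t -> top t' = top t ->
  uniq (labels t) -> same_sides rho v u ->
  (forall a, inr a \notin inner t -> u_diag v a = u_diag u a) ->
  tree_len rho v t' = tree_len rho u t.
Proof.
move=> hl ht /= /andP[ut _] hs hd; rewrite /tree_len hl ht.
by apply: eq_edge_len => // a ea; apply: hd; rewrite -ea.
Qed.

(** The two maps move disjoint sets of diagonals, and neither moves the edges of the root triangle;
    so that triangle keeps its lengths and each map preserves feasibility of the other subtree. *)
Lemma flip_equiv_Node x l l' r r' :
  uniq (labels (Node x l r)) -> flip_equiv l l' -> flip_equiv r r' ->
  flip_equiv (Node x l r) (Node x l' r').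
Proof.
move=> ux [l1 r1 p1 [T1 g1 h1]] [l2 r2 p2 [T2 g2 h2]].
have [ul ur xl xr dis] := uniq_labels_Node ux.
split.
- by rewrite /= l1 l2.
- by [].
- by rewrite /= r1 r2 !(perm_cat, perm_cons) //; apply: perm_cat; rewrite perm_cons.
exists (T2 \o T1); first exact: rho_pl_comp.
move=> u; have [s1 d1 f1] := h1 u; have [s2 d2 f2] := h2 (T1 u).
have s12 : same_sides rho (T2 (T1 u)) u := same_sides_trans s2 s1.
have inl_l a : inr a \in labels l -> u_diag (T2 (T1 u)) a = u_diag (T1 u) a.
  by move=> /dis; rewrite inE negb_or => /andP[_ ?]; rewrite d2.
have inr_r a : inr a \in labels r -> u_diag (T1 u) a = u_diag u a.
  move=> ha; rewrite d1 //; apply/negP => ha'.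
  by have := dis (inr a); rewrite inE ha' orbT => /(_ isT)/negP.
have dT a : inr a \notin inner l -> inr a \notin inner r ->
    u_diag (T2 (T1 u)) a = u_diag u a by move=> ? ?; rewrite d2 // d1.
split=> //.
  move=> a; rewrite mem_cat !inE !negb_or => /andP[/andP[_ ?] /andP[_ ?]].
  exact: dT.
have El : tree_len rho (T2 (T1 u)) l' = tree_len rho u l.
  rewrite -(@tree_len_flip l l' u (T1 u)) //.
  by apply: eq_edge_len => // a ea; apply: inl_l; rewrite inE -ea r1 eqxx.
have Er : tree_len rho (T2 (T1 u)) r' = tree_len rho u r.
  rewrite (@tree_len_flip r r' (T1 u)) //.
  by apply: eq_edge_len => // a ea; apply: inr_r; rewrite inE -ea eqxx.
have Ex : tree_len rho (T2 (T1 u)) (Node x l' r') = tree_len rho u (Node x l r).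
  apply: tree_len_flip => //; first by rewrite /= l1 l2.
  move=> a; rewrite mem_cat !inE !negb_or => /andP[/andP[_ ?] /andP[_ ?]].
  exact: dT.
have Fl : feasible rho l' (T2 (T1 u)) <-> feasible rho l u.
  have lab a : inr a \in labels l' -> u_diag (T2 (T1 u)) a = u_diag (T1 u) a.
    by rewrite inE (perm_mem p1) r1 -in_cons; exact: inl_l.
  rewrite -f1; split; first exact: eq_feasible s2 lab.
  by apply: (eq_feasible (same_sides_sym s2)) => a /lab.
have Fr : feasible rho r' (T2 (T1 u)) <-> feasible rho r u.
  rewrite f2; split; first exact: eq_feasible s1 inr_r.
  by apply: (eq_feasible (same_sides_sym s1)) => a /inr_r.
by rewrite /= Ex El Er; split=> -[h /Fl hl /Fr hr]; split.
Qed.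

End FlipEquivalence.

(** * A rotation as an integral shear *)

Section Rotation.
Variables (n : nat) (R : realType) (rho : R).
Implicit Types (t l r A B C : tree n).
Local Notation rV := 'rV[R]_(n.-1 + (n - 3)).

(** The field itself as a bundled subring: specialising to it yields continuity and piecewise
    linearity over the reals. *)
Definition whole_ring : {pred R} := predT.

Fact whole_ring_subring : GRing.subring_closed whole_ring.
Proof. by []. Qed.
HB.instance Definition _ := GRing.isSubringClosed.Build R whole_ring whole_ring_subring.

(** The hypotheses of [rho_pl_shear] for the coordinate of the diagonal [b]. *)
Definition rho_form (b : 'I_(n - 3)) (f : rV -> R) : Prop :=
  [/\ forall u c, f (u + c *: delta_mx 0 (rshift n.-1 b)) = f u, continuous f &
      forall S : subringClosed R, rho \in S -> pl_function S f].

Lemma rho_form_affine b f :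
  (forall u c, f (u + c *: delta_mx 0 (rshift n.-1 b)) = f u) ->
  (forall S : subringClosed R, rho \in S -> affine_form S f) -> rho_form b f.
Proof.
move=> hb ha; split=> //; first exact: affine_form_continuous (ha whole_ring isT).
by move=> S rS; apply: pl_function_affine; exact: ha.
Qed.

Lemma rho_form_max b f g : rho_form b f -> rho_form b g ->
  rho_form b (fun u => Num.max (f u) (g u)).
Proof.
move=> [f1 f2 f3] [g1 g2 g3]; split.
- by move=> u c; rewrite f1 g1.
- by move=> u; apply: continuous_max; [exact: f2 | exact: g2].
- by move=> S rS; apply: pl_function_max; [exact: f3 | exact: g3].
Qed.

Lemma rho_formB b f g : rho_form b f -> rho_form b g -> rho_form b (fun u => f u - g u).
Proof.
move=> [f1 f2 f3] [g1 g2 g3]; split.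
- by move=> u c; rewrite f1 g1.
- by move=> u; apply: cvgB (f2 u) (g2 u).
- by move=> S rS; apply: pl_functionB; [exact: f3 | exact: g3].
Qed.

Lemma rho_pl_shear_form b f : rho_form b f -> rho_pl rho (shear (rshift n.-1 b) f).
Proof. by case=> *; exact: rho_pl_shear. Qed.

Lemma perm_eq_rotation (T : eqType) (x : T) (a b c : seq T) :
  perm_eq (a ++ x :: b ++ c) ((x :: a ++ b) ++ c).
Proof. by rewrite (perm_catCA a [:: x]) /= catA. Qed.

(** The new diagonal inherits the index [b]. Substituting l = h_AB - u_b and l' = h_BC - u_b' into
    l' = l - m + m' gives u_b' = u_b + (m - h_AB) - (m' - h_BC), a shear in u_b whose amount does
    not involve u_b. *)
Lemma flip_equiv_rotation x b A B C :
  let t := Node x (Node (inr b) A B) C in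
  uniq (labels t) -> integral_edge rho x (leaves t) ->
  integral_edge rho (top A) (leaves A) -> integral_edge rho (top B) (leaves B) ->
  integral_edge rho (top C) (leaves C) ->
  flip_equiv rho t (Node x A (Node (inr b) B C)).
Proof.
move=> t ut iX iA iB iC; set t' := Node x A _.
have [u1 u2 xAB xC dAB_C] := uniq_labels_Node ut.
have [uA uB bA bB dA_B] := uniq_labels_Node u1.
have bC : inr b \notin labels C by apply: dAB_C; rewrite inE eqxx.
have bx : x != inr b by apply: contraNneq xAB => ->; rewrite inE eqxx.
pose len u (s : tree n) := tree_len rho u s.
pose h u (s : tree n) := half_perimeter rho u (leaves s).
pose HAB u := h u A + h u B; pose HBC u := h u B + h u C.
(* The half-sums are subtracted inside the maxima so that each entry by itself is an affine form
   over any subring containing [rho]. *)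
pose lower u := max4 (len u A - len u B - HAB u) (len u B - len u A - HAB u)
                     (len u t - len u C - HAB u) (len u C - len u t - HAB u).
pose lower' u := max4 (len u B - len u C - HBC u) (len u C - len u B - HBC u)
                      (len u A - len u t - HBC u) (len u t - len u A - HBC u).
have lt' : leaves t' = leaves t by rewrite /= catA.
have ht u : h u t = h u A + h u B + h u C by rewrite /h /= !half_perimeter_cat.
have hS u c i : u_side rho (u + c *: delta_mx 0 (rshift n.-1 b)) i = u_side rho u i.
  exact: u_side_diag_shift.
have hh u c s : h (u + c *: delta_mx 0 (rshift n.-1 b)) s = h u s.
  exact: eq_half_perimeter.
have hD u c a : a != b -> u_diag (u + c *: delta_mx 0 (rshift n.-1 b)) a = u_diag u a.
  by move=> /negbTE ab; rewrite u_diag_diag_shift ab mul0r addr0.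
have hlen u c s : top s != inr b ->
    len (u + c *: delta_mx 0 (rshift n.-1 b)) s = len u s.
  move=> sb; apply: eq_edge_len => // a ea; apply: hD.
  by apply: contraNneq sb => <-; rewrite ea.
have top_neq s : inr b \notin labels s -> top s != inr b.
  by apply: contraNneq => <-; rewrite inE eqxx.
have tA := top_neq _ bA; have tB := top_neq _ bB; have tC := top_neq _ bC.
have aS (s : tree n) : integral_edge rho (top s) (leaves s) ->
    forall S : subringClosed R, rho \in S -> affine_form S (fun u => len u s - h u s).
  by [].
(* Doubled half-sums are the corrections between the entries and combinations of the forms in [aS]:
   for instance A - B - h_A - h_B = (A - h_A) - (B - h_B) - 2 h_B. *)
have aH (s : tree n) (S : subringClosed R) : rho \in S ->
    affine_form S (fun u => h u s + h u s).
  move=> rS; have := @affine_form_sum _ _ S _ (leaves s) predT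
    (fun i u => u_side rho u i) (fun i => affine_form_u_side i rS).
  congr affine_form; apply/funext => u; rewrite /h /half_perimeter; lra.
have ext (S : subringClosed R) (f g : rV -> R) :
    affine_form S f -> f =1 g -> affine_form S g by move=> + /funext <-.
have gform : rho_form b (fun u => lower u - lower' u).
  have inv f : [/\ (forall u c, f (u + c *: delta_mx 0 (rshift n.-1 b)) = f u) &
      forall S : subringClosed R, rho \in S -> affine_form S f] -> rho_form b f.
    by case=> *; exact: rho_form_affine.
  apply: rho_formB; apply: rho_form_max; apply: rho_form_max; apply: inv;
    (split=> [u c|S rS]; first by rewrite /HAB /HBC !hlen // !hh);
    have dA := aS _ iA S rS; have dB := aS _ iB S rS; have dC := aS _ iC S rS;
    have dX := aS t iX S rS; have dHA := aH A S rS; have dHB := aH B S rS;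
    have dHC := aH C S rS.
  - by apply: ext (affine_formB (affine_formB dA dB) dHB) _ => u; rewrite /HAB; lra.
  - by apply: ext (affine_formB (affine_formB dB dA) dHA) _ => u; rewrite /HAB; lra.
  - by apply: ext (affine_formB dX dC) _ => u; rewrite /HAB ht; lra.
  - by apply: ext (affine_formB (affine_formB (affine_formB dC dX) dHA) dHB) _ => u;
      rewrite /HAB ht; lra.
  - by apply: ext (affine_formB (affine_formB dB dC) dHC) _ => u; rewrite /HBC; lra.
  - by apply: ext (affine_formB (affine_formB dC dB) dHB) _ => u; rewrite /HBC; lra.
  - by apply: ext (affine_formB (affine_formB (affine_formB dA dX) dHB) dHC) _ => u;
      rewrite /HBC ht; lra.
  - by apply: ext (affine_formB dX dA) _ => u; rewrite /HBC ht; lra.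
split=> //.
  exact: perm_eq_rotation.
exists (shear (rshift n.-1 b) (fun u => lower u - lower' u)).
  exact: rho_pl_shear_form.
move=> u; rewrite /shear; set g := lower u - lower' u; set v := u + _.
have sv : same_sides rho v u by move=> i; exact: hS.
have dv a : a != b -> u_diag v a = u_diag u a by exact: hD.
split=> //.
  move=> a /= ha; apply: dv; apply: contraNneq ha => ->.
  by rewrite inE eqxx.
have dvl s : inr b \notin labels s -> forall a, inr a \in labels s -> u_diag v a = u_diag u a.
  by move=> bs a /= sa; apply: dv; apply: contraNneq bs => <-.
have fs s : inr b \notin labels s -> feasible rho s v <-> feasible rho s u.
  move=> bs; split; first exact: eq_feasible sv (dvl s bs).
  by apply: (eq_feasible (same_sides_sym sv)) => a /(dvl s bs).
have FA := fs _ bA; have FB := fs _ bB; have FC := fs _ bC.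
have [EA EB EC] : [/\ len v A = len u A, len v B = len u B & len v C = len u C].
  by rewrite /v !hlen.
have Et : len v t' = len u t by rewrite -(hlen u g t) // /len /tree_len lt'.
(* Back in terms of lengths the half-sums cancel, leaving l' - m' = l - m. *)
have /quadrilateral_flip Q : len v (Node (inr b) B C) -
    max4 (len u B - len u C) (len u C - len u B) (len u A - len u t) (len u t - len u A) =
    len u (Node (inr b) A B) -
    max4 (len u A - len u B) (len u B - len u A) (len u t - len u C) (len u C - len u t).
  rewrite /len /tree_len /= !half_perimeter_cat !(eq_half_perimeter _ sv).
  rewrite /v u_diag_diag_shift eqxx mul1r /g /lower /lower' !max4B /HAB /HBC /h.
  rewrite /len /tree_len; lra.
split=> [[h1 hA [h2 hB hC]]|[h1 [h2 hA hB] hC]].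
  have [q1 q2] : triangle_ineq (len u t) (len u (Node (inr b) A B)) (len u C) /\
                 triangle_ineq (len u (Node (inr b) A B)) (len u A) (len u B).
    by apply/Q; rewrite -EA -EB -EC -Et.
  by split=> //; [split=> //; [exact/FA | exact/FB] | exact/FC].
have [q1 q2] : triangle_ineq (len u t) (len u A) (len v (Node (inr b) B C)) /\
               triangle_ineq (len v (Node (inr b) B C)) (len u B) (len u C).
  exact/Q.
rewrite -EA -EB -EC -Et in q1 q2.
by split=> //; [exact/FA | split=> //; [exact/FB | exact/FC]].
Qed.

End Rotation.

(** * Reduction to right combs *)

Section Combs.
Variables (n : nat) (R : realType) (rho : R).
Implicit Types (t l r : tree n) (u : 'rV[R]_(n.-1 + (n - 3))).

(** Each pair in [zs] is a diagonal on the spine with the leaf hanging to the left of its node;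
    renumbering diagonals then acts on first components only. *)
Fixpoint comb (x : edge n) (i : 'I_n) (zs : seq ('I_(n - 3) * 'I_n)) (z : 'I_n) : tree n :=
  match zs with
  | [::] => Node x (Leaf i) (Leaf z)
  | (a, j) :: zs' => Node x (Leaf i) (comb (inr a) j zs' z)
  end.

Lemma flip_equiv_uniq t t' : flip_equiv rho t t' -> uniq (labels t) -> uniq (labels t').
Proof.
by case=> _ h p _; rewrite /= h (perm_mem p) (perm_uniq p).
Qed.

(** A rotation replaces the left subtree by its own left subtree and keeps the leaves, so induction
    on the left subtree ends with a leaf there. The right subtree then has fewer leaves than the
    whole, which is the outer induction. *)
Lemma flip_equiv_comb x l r :
  diag_nodes l -> diag_nodes r -> uniq (labels (Node x l r)) ->
  integral_edge rho x (leaves (Node x l r)) ->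
  exists i zs z, flip_equiv rho (Node x l r) (comb x i zs z).
Proof.
have [m] := ubnP (size (leaves l) + size (leaves r)).
elim: m x l r => // m IHm x l; elim: l => [i|e A IHA B _] r.
  case: r => [z _ _ _ _ _|[//|a] rl rr].
    by exists i, [::], z; exact: flip_equiv_refl.
  move=> sz _ dr ut _; have /andP[drl drr] : diag_nodes rl && diag_nodes rr by [].
  have [_ ur _ _ _] := uniq_labels_Node ut.
  have [||j [zs [z h]]] // := IHm (inr a) rl rr _ drl drr ur.
  - by move: sz; rewrite /= size_cat; lia.
  - exact: integral_edge_diag.
  exists i, ((a, j) :: zs), z.
  exact: flip_equiv_Node ut (flip_equiv_refl _ _) h.
case: e => [//|b]; move=> sz /andP[_ /andP[dA dB]] dr ut ix.
have F := flip_equiv_rotation ut ix (@integral_edge_tree n R rho _ dA)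
  (@integral_edge_tree n R rho _ dB) (@integral_edge_tree n R rho _ dr).
have [lE _ _ _] := F.
have [|||||i [zs [z h]]] := IHA (Node (inr b) B r).
- by move: sz; rewrite /= !size_cat; lia.
- exact: dA.
- by apply/and3P.
- exact: flip_equiv_uniq F ut.
- by rewrite lE.
by exists i, zs, z; exact: flip_equiv_trans F h.
Qed.

Lemma leaves_comb x i zs z : leaves (comb x i zs z) = i :: rcons (map snd zs) z.
Proof. by elim: zs x i => //= -[a j] zs IH x i /=; rewrite IH. Qed.

(** Two root labels are allowed because the induction descends to the diagonals [s a] and [a]. *)
Lemma feasible_comb_relabel (s : 'I_(n - 3) -> 'I_(n - 3)) u v x y i zs z :
  same_sides rho u v ->
  (forall k, k \in map fst zs -> u_diag u (s k) = u_diag v k) ->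
  (forall w, edge_len rho u x w = edge_len rho v y w) ->
  feasible rho (comb x i [seq (s c.1, c.2) | c <- zs] z) u <->
  feasible rho (comb y i zs z) v.
Proof.
move=> huv; elim: zs x y i => [|[a j] zs IH] x y i hs hxy.
  by rewrite /= /tree_len /= hxy !huv.
have ha w : edge_len rho u (inr (s a)) w = edge_len rho v (inr a) w.
  by rewrite /= hs ?inE ?eqxx // (eq_half_perimeter _ huv).
have {}IH := IH (inr (s a)) (inr a) j _ ha.
have hc : tree_len rho u (comb (inr (s a)) j [seq (s c.1, c.2) | c <- zs] z) =
          tree_len rho v (comb (inr a) j zs z).
  rewrite /tree_len !leaves_comb -map_comp.
  by case: (zs) => [|[b k] ?]; exact: ha.
have hx : tree_len rho u (comb x i [seq (s c.1, c.2) | c <- (a, j) :: zs] z) =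
          tree_len rho v (comb y i ((a, j) :: zs) z).
  by rewrite /tree_len !leaves_comb -map_comp; exact: hxy.
rewrite /= in hx *; rewrite hx hc /tree_len /= huv.
have {}IH : feasible rho (comb (inr (s a)) j [seq (s c.1, c.2) | c <- zs] z) u <->
            feasible rho (comb (inr a) j zs z) v.
  by apply: IH => k hk; apply: hs; rewrite inE hk orbT.
by split=> -[h _ /IH h']; split.
Qed.

End Combs.

(** * Counting non-crossing diagonals under a chord *)

Section DiagonalCount.
Variables (n : nat) (G : triangulation n).

Local Notation src a := (nat_of_ord (diag G a).1).
Local Notation tgt a := (nat_of_ord (diag G a).2).

Lemma diag_wide a : (src a + 2 <= tgt a)%N.
Proof.
have /and3P[h1 h2 _] := diagP G a; move: h1 h2; rewrite -val_eqE /=.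
move=> h1; have h3 := ltn_ord (diag G a).2.
rewrite modn_small; last exact: leq_ltn_trans h3.
by move=> /eqP h; lia.
Qed.

Lemma diag_not_closing a : ~~ ((src a == 0) && (tgt a == n.-1)).
Proof.
have /and3P[h1 _ h2] := diagP G a; move: h2; rewrite -val_eqE /=.
apply: contra => /andP[/eqP h /eqP h']; have h3 := ltn_ord (diag G a).2.
by rewrite h h' prednK ?modnn //; apply: leq_ltn_trans h3.
Qed.

Lemma diag_inj_nat a b : src a = src b -> tgt a = tgt b -> a = b.
Proof.
move=> h1 h2; apply: (@diag_inj _ G); rewrite [LHS]surjective_pairing [RHS]surjective_pairing.
by congr pair; apply: val_inj.
Qed.

Lemma diag_nested a b : ~~ [&& src a < src b, src b < tgt a & tgt a < tgt b]%N.
Proof.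
by have := diag_noncrossing G a b; apply: contra => /and3P[h1 h2 h3]; rewrite /crossing h1 h2 h3.
Qed.

Definition within i j : {set 'I_(n - 3)} := [set a | (i <= src a)%N && (tgt a <= j)%N].

Definition inside i j : {set 'I_(n - 3)} :=
  [set a in within i j | ~~ ((src a == i) && (tgt a == j))].

(** Let [w] be the far end of the longest inside diagonal starting at [i], or i + 1 if there is
    none. A diagonal passing over [w] would start at [i] and be longer, or cross the chosen one. *)
Lemma inside_split i j : (i.+1 < j)%N ->
  exists w, [/\ (i < w)%N, (w < j)%N & inside i j \subset within i w :|: within w j].
Proof.
move=> ij.
have [w [iw wj hw]] : exists w, [/\ (i < w)%N, (w < j)%N &
    forall a, a \in inside i j -> ~~ ((src a < w)%N && (w < tgt a)%N)].
  case: (pickP [pred a in inside i j | src a == i]) => [a0 h0|h0]; last first.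
    exists i.+1; split=> // a ha; have := h0 a; rewrite /= ha /=.
    by move: ha; rewrite !inE; lia.
  have [a /andP[ha /eqP sa] amax] := @arg_maxnP _ a0 [pred a in inside i j | src a == i]
    (fun a => tgt a) h0.
  have := ha; rewrite !inE => /andP[/andP[_ taj]]; rewrite sa eqxx /= => taj'.
  have wa := diag_wide a; exists (tgt a); split; [lia|lia|].
  move=> b hb; apply/negP => /andP[h1 h2].
  have [sb|sb] := eqVneq (src b) i.
    by have := amax b; rewrite /= hb sb eqxx => /(_ isT); lia.
  have := diag_nested a b; move: hb; rewrite !inE; lia.
exists w; split=> //; apply/fintype.subsetP => a ha; have := hw _ ha.
by move: ha; rewrite !inE; lia.
Qed.

Lemma within_diag i j a : src a = i -> tgt a = j -> within i j = a |: inside i j.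
Proof.
move=> ha ha'; apply/setP => b; rewrite !inE.
have [->|ab] := eqVneq b a; first by rewrite ha ha' !leqnn.
suff -> : (src b == i) && (tgt b == j) = false by rewrite andbT.
by apply: contra_neqF ab => /andP[/eqP h /eqP h']; apply: diag_inj_nat; rewrite ?h ?h' ?ha ?ha'.
Qed.

Lemma within_inside i j : (forall a, ~~ ((src a == i) && (tgt a == j))) ->
  within i j = inside i j.
Proof. by move=> h; apply/setP => b; rewrite !inE h andbT. Qed.

Lemma card_within_le i j : (#|within i j| <= (#|inside i j|).+1)%N.
Proof.
have [a /andP[/eqP h /eqP h']|h0] := pickP [pred a | (src a == i) && (tgt a == j)].
  by rewrite (within_diag h h') cardsU1; case: (_ \notin _).
by rewrite within_inside ?leqnSn // => a; have /= -> := h0 a.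
Qed.

(** The chord cuts off a polygon with j - i + 1 vertices, hence at most three fewer diagonals.
    Inductively, the two parts of a split contribute (w - i - 1) + (j - w - 1). *)
Lemma card_inside i j : (i < j)%N -> (#|inside i j| <= j - i - 2)%N.
Proof.
have [m] := ubnP (j - i)%N; elim: m i j => // m IH i j mij ij.
have [ji|ji] := eqVneq j i.+1.
  rewrite (_ : inside i j = finset.set0) ?cards0 //; apply/setP => a; rewrite !inE ji.
  have := diag_wide a; lia.
have [|w [iw wj sub]] := @inside_split i j; first by lia.
apply: leq_trans (subset_leq_card sub) _; apply: leq_trans (leq_card_setU _ _) _.
(* Counting the chord itself raises the bound by one. The case q = p + 1 is separate: there the
   truncated q - p - 2 is already 0, so the bound would come out one too large. *)
have hi p q : (p < q)%N -> (q - p < m)%N -> (#|within p q| <= q - p - 1)%N.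
  move=> pq hm; have [qp|qp] := eqVneq q p.+1.
    rewrite (_ : within p q = finset.set0) ?cards0 //; apply/setP => a; rewrite !inE qp.
    have := diag_wide a; lia.
  have := card_within_le p q; have := IH p q hm pq; lia.
have h1 := hi i w iw; have h2 := hi w j wj; lia.
Qed.

Lemma card_within i j : (i < j)%N -> (#|within i j| <= j - i - 1)%N.
Proof.
move=> ij; have [ji|ji] := eqVneq j i.+1.
  rewrite (_ : within i j = finset.set0) ?cards0 //; apply/setP => a; rewrite !inE ji.
  have := diag_wide a; lia.
have := card_within_le i j; have := card_inside ij; lia.
Qed.

(** The bounds for the two parts add up exactly to the bound for the whole, so equality forces
    equality in both. *)
Lemma inside_maximal_split i j : (i.+1 < j)%N -> #|inside i j| = (j - i - 2)%N ->
  exists w, [/\ (i < w)%N, (w < j)%N, #|within i w| = (w - i - 1)%N &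
                #|within w j| = (j - w - 1)%N].
Proof.
move=> ij c; have [w [iw wj sub]] := inside_split ij; exists w.
have := leq_trans (subset_leq_card sub) (leq_card_setU _ _).
have := card_within iw; have := card_within wj; rewrite c; split=> //; lia.
Qed.

(** The count exceeds by one what fits under the chord, so the chord must itself be a diagonal. *)
Lemma within_maximal i j : (i.+1 < j)%N -> #|within i j| = (j - i - 1)%N ->
  (exists a, src a = i /\ tgt a = j) /\ #|inside i j| = (j - i - 2)%N.
Proof.
move=> ij c; have ci := card_inside (ltnW ij).
have [a /andP[/eqP h /eqP h']|h0] := pickP [pred a | (src a == i) && (tgt a == j)].
  by split; [exists a | have := card_within_le i j; lia].
move: c; rewrite within_inside; last by move=> a; have /= -> := h0 a.
lia.
Qed.

(** This is the equality case of [card_inside] for the closing side, from which the recursive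
    splitting starts. *)
Lemma card_inside_all : #|inside 0 n.-1| = (n - 3)%N.
Proof.
rewrite -[RHS]card_ord -cardsT; congr #|pred_of_set _|; apply/setP => a.
rewrite !inE leq0n diag_not_closing andbT /=.
by have := ltn_ord (diag G a).2; lia.
Qed.

End DiagonalCount.

(** * The tree of a triangulation *)

Section TriangulationTree.
Variables (n : nat) (G : triangulation n).
Hypothesis n_ge3 : (3 <= n)%N.
Implicit Types (t l r : tree n) (e f g : edge n).

Local Notation src a := (nat_of_ord (diag G a).1).
Local Notation tgt a := (nat_of_ord (diag G a).2).

(* The closing side, from vertex n - 1 to vertex 0, is the chord (0, n - 1). *)
Definition span e : nat * nat :=
  match e with
  | inl k => if k == n.-1 :> nat then (0%N, n.-1) else (nat_of_ord k, k.+1)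
  | inr a => (src a, tgt a)
  end.

Lemma span_lt e : ((span e).1 < (span e).2)%N && ((span e).2 < n)%N.
Proof.
case: e => [k|a] /=; last by have := diag_wide G a; have := ltn_ord (diag G a).2; lia.
by have := ltn_ord k; case: eqP => /= h; lia.
Qed.

Lemma span_inj : injective span.
Proof.
move=> e f h; have h1 : (span e).1 = (span f).1 by rewrite h.
have {h}h2 : (span e).2 = (span f).2 by rewrite h.
case: e f h1 h2 => [k|a] [k'|b] /=.
- have := ltn_ord k; have := ltn_ord k'.
  by do 2 case: eqP => ? /=; intros; try lia; congr inl; apply: val_inj => /=; lia.
- by have := diag_wide G b; have := diag_not_closing G b; case: (nat_of_ord k =P n.-1) => ? /=; lia.
- by have := diag_wide G a; have := diag_not_closing G a; case: (nat_of_ord k' =P n.-1) => ? /=; lia.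
by move=> h1 h2; congr inr; exact: diag_inj_nat h1 h2.
Qed.

Lemma span_nested e f :
  ~~ [&& (span e).1 < (span f).1, (span f).1 < (span e).2 & (span e).2 < (span f).2]%N.
Proof.
have := span_lt f; case: e f => [k|a] [k'|b] /=; last by rewrite diag_nested.
- by case: (nat_of_ord k =P n.-1) => ?; case: (nat_of_ord k' =P n.-1) => ? /=; lia.
- by case: (nat_of_ord k =P n.-1) => ? /=; lia.
- by case: (nat_of_ord k' =P n.-1) => ? /=; lia.
Qed.

(** The vertex [w] is the apex of the triangle resting on the chord (i, j). *)
Fixpoint spans t (i j : nat) : Prop :=
  match t with
  | Leaf k => k = i :> nat /\ j = i.+1
  | Node e l r => span e = (i, j) /\ exists w, spans l i w /\ spans r w j
  end.

Lemma spans_lt t i j : spans t i j -> (i < j)%N.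
Proof.
case: t => [k [_ ->]|e l r [h _]] //=.
by have := span_lt e; rewrite h => /andP[].
Qed.

(** The bound on [j] excludes the leaf n - 1, which [span] sends to the chord (0, n - 1). *)
Lemma spans_top t i j : (j < n)%N -> spans t i j -> span (top t) = (i, j).
Proof.
case: t => [k jn [<- h]|e l r _ [h _]] //=.
by case: eqP => [h'|_]; rewrite ?h //; lia.
Qed.

Lemma tree_within i j : (i < j)%N -> (j < n)%N -> #|within G i j| = (j - i - 1)%N ->
  exists2 t, spans t i j & diag_nodes t.
Proof.
have [m] := ubnP (j - i)%N; elim: m i j => // m IH i j mij ij jn c.
have [ji|ji] := eqVneq j i.+1.
  by exists (Leaf (Ordinal (ltn_trans ij jn))).
have ij1 : (i.+1 < j)%N by lia.
have [[a [sa ta]] ci] := within_maximal ij1 c.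
have [w [iw wj c1 c2]] := inside_maximal_split ij1 ci.
have [||||l hl dl] // := IH i w; try by lia.
have [||||r hr dr] // := IH w j; try by lia.
exists (Node (inr a) l r); last exact/and3P.
by split; [rewrite /= sa ta | exists w].
Qed.

Fact closing_side_subproof : (n.-1 < n)%N.
Proof. by lia. Qed.

Definition closing_side : 'I_n := Ordinal closing_side_subproof.

Definition triangulation_tree t : Prop :=
  exists l r, [/\ t = Node (inl closing_side) l r, spans t 0 n.-1, diag_nodes l & diag_nodes r].

Lemma triangulation_tree_exists : exists t, triangulation_tree t.
Proof.
have n1 : (1 < n.-1)%N by lia.
have c : #|inside G 0 n.-1| = (n.-1 - 0 - 2)%N by rewrite card_inside_all; lia.
have [w [w0 wn c1 c2]] := inside_maximal_split n1 c.
have [|l hl dl] := tree_within w0 _ c1; first by lia.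
have [|r hr dr] := tree_within wn _ c2; first by lia.
exists (Node (inl closing_side) l r), l, r; split=> //.
by split; [rewrite /= eqxx | exists w].
Qed.

(** Each triangle is listed with a fixed order of edges: the one facing the root, then left, then
    right. *)
Fixpoint in_triangles t e f g : Prop :=
  match t with
  | Leaf _ => False
  | Node x l r => [\/ [/\ e = x, f = top l & g = top r], in_triangles l e f g |
                      in_triangles r e f g]
  end.

(** Unless the triangle lies on one side of the apex [w], the chord (x, z) passes over [w]; not
    crossing (i, w) and (w, j) forces x = i and z = j, and then (x, y) and (y, z) force y = w. *)
Lemma in_triangles_complete t i j e f g x y z :
  spans t i j -> (j < n)%N -> (i <= x)%N -> (x < y)%N -> (y < z)%N -> (z <= j)%N ->
  span e = (x, z) -> span f = (x, y) -> span g = (y, z) -> in_triangles t e f g.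
Proof.
elim: t i j => [k i j [_ ->]|a l IHl r IHr i j [ha [w [hl hr]]]]; first by lia.
move=> jn ix xy yz zj he hf hg.
have iw := spans_lt hl; have wj := spans_lt hr; have wn := ltn_trans wj jn.
have [zw|wz] := leqP z w; first by apply: Or32; exact: (IHl i w).
have [wx|xw] := leqP w x; first by apply: Or33; exact: (IHr w j).
have tl := spans_top wn hl; have tr := spans_top jn hr.
have /andP[/eqP xi /eqP zj'] : (x == i) && (z == j).
  have := span_nested (top l) e; have := span_nested e (top r).
  by rewrite tl tr he /=; lia.
subst i j; have yw : y = w.
  have := span_nested f (top r); have := span_nested (top l) g.
  by rewrite tl tr hf hg /=; lia.
by subst w; apply: Or31; split; apply: span_inj; rewrite ?he ?hf ?hg.
Qed.

Lemma in_triangles_span t i j e f g : spans t i j -> (j < n)%N -> in_triangles t e f g ->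
  exists x y z, [/\ (i <= x < y)%N, (y < z <= j)%N &
    [/\ span e = (x, z), span f = (x, y) & span g = (y, z)]].
Proof.
elim: t i j => [//|a l IHl r IHr i j [ha [w [hl hr]]]] jn.
have iw := spans_lt hl; have wj := spans_lt hr; have wn := ltn_trans wj jn.
case=> [[-> -> ->]|h|h].
- exists i, w, j; rewrite iw wj !leqnn; split=> //.
  by rewrite (spans_top wn hl) (spans_top jn hr).
- have [x [y [z [h1 h2 h3]]]] := IHl _ _ hl wn h; exists x, y, z; split=> //; lia.
- have [x [y [z [h1 h2 h3]]]] := IHr _ _ hr jn h; exists x, y, z; split=> //; lia.
Qed.

Lemma labels_complete t i j e : spans t i j -> (j < n)%N ->
  (i <= (span e).1)%N -> ((span e).2 <= j)%N -> e \in labels t.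
Proof.
elim: t i j => [k i j ht jn|a l IHl r IHr i j [ha [w [hl hr]]] jn] ix yj.
  have hk : span (inl k) = (i, j) := spans_top jn ht; have := span_lt e; rewrite inE.
  move: ht => [_ hj] he; apply/eqP; apply: span_inj.
  rewrite [LHS]surjective_pairing hk; congr pair; lia.
have iw := spans_lt hl; have wj := spans_lt hr; have wn := ltn_trans wj jn.
have -> : labels (Node a l r) = a :: labels l ++ labels r by [].
rewrite inE mem_cat.
have [zw|wz] := leqP (span e).2 w; first by rewrite (IHl i w) ?orbT.
have [wx|xw] := leqP w (span e).1; first by rewrite (IHr w j) ?orbT.
have := span_nested (top l) e; have := span_nested e (top r).
rewrite (spans_top wn hl) (spans_top jn hr) /= => h1 h2.
apply/orP; left; apply/eqP; apply: span_inj; rewrite ha [LHS]surjective_pairing.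
by congr pair; lia.
Qed.

Lemma labels_span t i j e : spans t i j -> (j < n)%N -> e \in labels t ->
  (i <= (span e).1)%N && ((span e).2 <= j)%N.
Proof.
elim: t i j => [k i j ht jn|a l IHl r IHr i j [ha [w [hl hr]]] jn].
  by rewrite inE => /eqP->; rewrite (spans_top jn ht) /= !leqnn.
have iw := spans_lt hl; have wj := spans_lt hr; have wn := ltn_trans wj jn.
have -> : labels (Node a l r) = a :: labels l ++ labels r by [].
rewrite inE mem_cat => /or3P[/eqP->|/(IHl _ _ hl wn)|/(IHr _ _ hr jn)]; last by lia.
  by rewrite ha /= !leqnn.
by lia.
Qed.

Lemma uniq_labels t i j : spans t i j -> (j < n)%N -> uniq (labels t).
Proof.
elim: t i j => [//|a l IHl r IHr i j [ha [w [hl hr]]] jn].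
have iw := spans_lt hl; have wj := spans_lt hr; have wn := ltn_trans wj jn.
have -> : labels (Node a l r) = a :: labels l ++ labels r by [].
rewrite cons_uniq cat_uniq mem_cat negb_or (IHl i w) // (IHr w j) // andbT andTb.
rewrite -andbA; apply/and3P; split.
- by apply/negP => /(labels_span hl wn); rewrite ha /=; lia.
- by apply/negP => /(labels_span hr jn); rewrite ha /=; lia.
apply/hasPn => e /(labels_span hr jn) h; apply/negP => /(labels_span hl wn).
by have := span_lt e; lia.
Qed.

Lemma leaves_spans t i j : spans t i j -> map val (leaves t) = iota i (j - i).
Proof.
elim: t i j => [k i j [/= -> ->]|a l IHl r IHr i j [_ [w [hl hr]]]].
  by rewrite subSnn.
have iw := spans_lt hl; have wj := spans_lt hr.
rewrite /= map_cat (IHl i w) // (IHr w j) //.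
by rewrite -[in iota w _](subnKC (ltnW iw)) -iotaD; congr iota; lia.
Qed.

End TriangulationTree.

(** * The polytope as the feasible set of the tree *)

Section DeltaFeasible.
Variables (n : nat) (G : triangulation n).
Hypothesis n_ge3 : (3 <= n)%N.
Variables (R : realType) (rho : R).
Implicit Types (t l r : tree n) (e f g : edge n) (u : 'rV[R]_(n.-1 + (n - 3))).

(** The side of each diagonal away from the closing side; it consists of the leaves below the
    diagonal in the tree. *)
Definition arcs (a : 'I_(n - 3)) : {set 'I_n} := side_arc (diag G a).

Lemma sum_leaves_spans t i j (F : 'I_n -> R) : spans G t i j ->
  \sum_(k <- leaves t) F k = \sum_(k < n | (i <= k < j)%N) F k.
Proof.
move=> ht; have hv := leaves_spans n_ge3 ht; have ij := spans_lt n_ge3 ht.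
rewrite big_uniq; last by rewrite -(map_inj_uniq val_inj) hv iota_uniq.
by apply: eq_bigl => k; rewrite -(mem_map val_inj) hv mem_iota /= subnKC // (ltnW ij).
Qed.

Lemma tree_len_spans t i j u : spans G t i j -> (j < n)%N ->
  tree_len rho u t = len rho arcs u (top t).
Proof.
move=> ht jn; rewrite /tree_len; have := spans_top n_ge3 jn ht.
case: (top t) => [k|a] //= [hi hj]; congr (_ + 2^-1 * _).
by rewrite (sum_leaves_spans _ ht); apply: eq_bigl => k; rewrite inE hi hj.
Qed.

Lemma set2_inj (a b x y : 'I_n) : (a < b)%N -> (x < y)%N ->
  [set a; b]%SET = [set x; y]%SET -> a = x /\ b = y.
Proof.
move=> ab xy /setP h; have := h a; have := h b; have := h x; have := h y.
rewrite !inE !eqxx ?orbT -!val_eqE /= => h1 h2 h3 h4.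
by split; apply: val_inj => /=; lia.
Qed.

Lemma ends_span e : exists p q : 'I_n,
  [/\ (p < q)%N, ends G e = [set p; q]%SET & span G e = (nat_of_ord p, nat_of_ord q)].
Proof.
case: e => [k|a] /=; last first.
  by exists (diag G a).1, (diag G a).2; split=> //; have := diag_wide G a; lia.
have kn := ltn_ord k; have n0 : (0 < n)%N by lia.
case: (nat_of_ord k =P n.-1) => hk.
  exists (ordS k), k; rewrite finset.setUC /= hk prednK // modnn; split=> //; lia.
by exists k, (ordS k); rewrite /= modn_small; [split|lia].
Qed.

Lemma ends_spanP e (x y : 'I_n) : (x < y)%N ->
  ends G e = [set x; y]%SET <-> span G e = (nat_of_ord x, nat_of_ord y).
Proof.
move=> xy; have [p [q [pq he hs]]] := ends_span e; rewrite he hs; split.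
  by move=> /(set2_inj pq xy)[-> ->].
by case=> h1 h2; rewrite (val_inj h1) (val_inj h2).
Qed.

Lemma feasible_triangles t i j u : spans G t i j -> (j < n)%N ->
  feasible rho t u <->
  (forall e f g, in_triangles t e f g ->
    triangle_ineq (len rho arcs u e) (len rho arcs u f) (len rho arcs u g)).
Proof.
elim: t i j => [//|a l IHl r IHr i j ht jn].
have [ha [w [hl hr]]] := ht.
have wn := ltn_trans (spans_lt n_ge3 hr) jn.
rewrite [feasible _ _ _]/= -/(feasible rho l u) -/(feasible rho r u).
rewrite (tree_len_spans u ht jn) (tree_len_spans u hl wn) (tree_len_spans u hr jn).
split=> [[h /(IHl _ _ hl wn) h1 /(IHr _ _ hr jn) h2] e f g|h].
  by case=> [[-> -> ->]|/h1|/h2].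
split; first by apply: h; apply: Or31.
- by apply/(IHl _ _ hl wn) => e f g h'; apply: h; apply: Or32.
- by apply/(IHr _ _ hr jn) => e f g h'; apply: h; apply: Or33.
Qed.

Lemma is_triangleP t e f g : spans G t 0 n.-1 -> in_triangles t e f g -> is_triangle G e f g.
Proof.
move=> ht /(in_triangles_span n_ge3 ht)[|x [y [z [h1 h2 [he hf hg]]]]]; first by lia.
have xn : (x < n)%N by lia.
have yn : (y < n)%N by lia.
have zn : (z < n)%N by lia.
exists (Ordinal zn), (Ordinal xn), (Ordinal yn); split.
- by rewrite /= !inE -!val_eqE /=; lia.
- by rewrite finset.setUC; apply/ends_spanP => //=; lia.
- by apply/ends_spanP => //=; lia.
- by apply/ends_spanP => //=; lia.
Qed.

(** Quantifying over predicates invariant under two generating transpositions says that (a, b, c) is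
    a reordering of (e, f, g). *)
Lemma triangle_in_tree t a b c : spans G t 0 n.-1 -> is_triangle G a b c ->
  exists e f g, in_triangles t e f g /\
    (forall P : edge n -> edge n -> edge n -> Prop,
      (forall x y z, P x y z -> P y x z) -> (forall x y z, P x y z -> P x z y) ->
      P e f g -> P a b c).
Proof.
move=> ht [x [y [z [/= /and3P[hxy hyz _] ea eb ec]]]].
have n1 : (n.-1 < n)%N by lia.
have key (p q s : 'I_n) e f g : (p < q)%N -> (q < s)%N -> ends G e = [set p; s]%SET ->
    ends G f = [set p; q]%SET -> ends G g = [set q; s]%SET -> in_triangles t e f g.
  move=> pq qs he hf hg; have ps := ltn_trans pq qs.
  apply: (@in_triangles_complete _ G n_ge3 t 0 n.-1 e f g p q s) => //.
  - by have := ltn_ord s; lia.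
  - exact/ends_spanP.
  - exact/ends_spanP.
  - exact/ends_spanP.
have ea' : ends G a = [set y; x]%SET by rewrite finset.setUC.
have eb' : ends G b = [set z; y]%SET by rewrite finset.setUC.
have ec' : ends G c = [set x; z]%SET by rewrite finset.setUC.
move: hxy hyz; rewrite !inE negb_or -!val_eqE /= => /andP[xy xz] yz.
have [xy'|yx'|?] := ltngtP x y; last by lia.
  have [yz'|zy'|?] := ltngtP y z; last by lia.
    by exists c, a, b; split; [exact: (key x y z) | move=> P s1 s2 h; exact: s2 (s1 _ _ _ h)].
  have [xz'|zx'|?] := ltngtP x z; last by lia.
    by exists a, c, b; split; [exact: (key x z y) | move=> P s1 s2 h; exact: s2].
  by exists b, c, a; split; [exact: (key z x y) | move=> P s1 s2 h; exact: s1 (s2 _ _ _ h)].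
have [xz'|zx'|?] := ltngtP x z; last by lia.
  by exists b, a, c; split; [exact: (key y x z) | move=> P s1 s2 h; exact: s1].
have [yz'|zy'|?] := ltngtP y z; last by lia.
  by exists a, b, c; split; [exact: (key y z x) | move=> P s1 s2 h].
by exists c, b, a; split; [exact: (key z y x) | move=> P s1 s2 h; exact: s1 (s2 _ _ _ (s1 _ _ _ h))].
Qed.

Lemma Delta_triangles t I u : spans G t 0 n.-1 ->
  Delta rho G I u <-> (forall e f g, in_triangles t e f g ->
    triangle_ineq (len rho I u e) (len rho I u f) (len rho I u g)).
Proof.
move=> ht; split=> [h e f g /(is_triangleP ht)|h a b c]; first exact: h.
move=> /(triangle_in_tree ht)[e [f [g [hefg hP]]]].
apply: (hP (fun x y z => triangle_ineq (len rho I u x) (len rho I u y) (len rho I u z)));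
  last exact: h.
- by move=> x y z; rewrite !triangle_ineqP => -[? ? ?]; split; lra.
- by move=> x y z; rewrite !triangle_ineqP => -[? ? ?]; split; lra.
Qed.

Lemma Delta_feasible t u : spans G t 0 n.-1 -> Delta rho G arcs u <-> feasible rho t u.
Proof.
move=> ht; have n1 : (n.-1 < n)%N by lia.
by rewrite (feasible_triangles u ht n1) (Delta_triangles arcs u ht).
Qed.

End DeltaFeasible.

(** * The closing side and the choice of the sets I *)

Section Normalisation.
Variables (n : nat) (R : realType) (rho : R).
Hypothesis n_ge3 : (3 <= n)%N.
Implicit Types (u : 'rV[R]_(n.-1 + (n - 3))).

Lemma u_side_indep u (k : 'I_n) (j : 'I_n.-1) : k = j :> nat ->
  u_side rho u k = u 0 (lshift (n - 3) j).
Proof.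
move=> kj; rewrite /u_side; case: insubP => [j' _ h|]; last by rewrite /= kj ltn_ord.
by congr (u 0 (lshift _ _)); apply: val_inj; rewrite h /= kj.
Qed.

Lemma u_side_closing u (k : 'I_n) : k = n.-1 :> nat ->
  u_side rho u k = 2 * rho - \sum_(j < n.-1) u 0 (lshift (n - 3) j).
Proof. by move=> kn; rewrite /u_side insubN //= kn ltnn. Qed.

Lemma sum_u_side u : \sum_(k < n) u_side rho u k = 2 * rho.
Proof.
have n0 : (n.-1 < n)%N by lia.
rewrite (bigD1 (Ordinal n0)) //= u_side_closing //.
rewrite (eq_bigl (fun k : 'I_n => (k < n.-1)%N)); last first.
  by move=> k; rewrite -val_eqE /=; have := ltn_ord k; lia.
rewrite (big_ord_narrow (ltnW n0)) /= [X in _ + X = _](eq_bigr (fun j => u 0 (lshift (n - 3) j))).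
  by rewrite subrK.
by move=> j _; exact: u_side_indep.
Qed.

Variable G : triangulation n.

(** The leaves are all the other sides, so the closing side has length rho - h, and rho - h - h is
    rho minus a full sum of side coordinates. *)
Lemma integral_edge_closing t : spans G t 0 n.-1 ->
  integral_edge rho (inl (closing_side n_ge3)) (leaves t).
Proof.
move=> ht S rS.
have /(affine_formB (affine_form_cst (n.-1 + (n - 3)) rS)) :=
  @affine_form_sum _ _ S _ (leaves t) predT (fun i u => u_side rho u i) (fun i => affine_form_u_side i rS).
congr affine_form; apply/funext => u; rewrite /= /half_perimeter.
have := sum_u_side u; rewrite (bigD1 (closing_side n_ge3)) //=.
rewrite (sum_leaves_spans n_ge3 _ ht).
rewrite (eq_bigl (fun k : 'I_n => (0 <= k < n.-1)%N)).
  by move=> h; lra.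
by move=> k; rewrite -val_eqE /=; have := ltn_ord k; lia.
Qed.

(** Passing to the complementary set of sides turns a half-sum S / 2 into rho - S / 2; shifting the
    diagonal coordinate by S - rho, a form over Z[rho], compensates. *)
Lemma Delta_arcs I : side_choice G I -> exists2 T, rho_pl rho T &
  forall u, Delta rho G (arcs G) (T u) <-> Delta rho G I u.
Proof.
move=> hI.
pose k a u := \sum_(i in arcs G a) u_side rho u i - rho.
have kE a u v : same_sides rho u v -> k a u = k a v.
  by move=> h; congr (_ - _); apply: eq_bigr => i _; exact: h.
have [T hT [hs hd]] : exists2 T, rho_pl rho T & (forall u, same_sides rho (T u) u) /\
    forall u a, u_diag (T u) a = u_diag u a + if I a != arcs G a then k a u else 0.
  (* The shears are composed one diagonal at a time; each amount [k b] depends on side coordinates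
     only, which none of them changes. *)
  suff hseq (s : seq 'I_(n - 3)) : uniq s -> exists2 T, rho_pl rho T &
      (forall u, same_sides rho (T u) u) /\
      forall u a, u_diag (T u) a = u_diag u a + if a \in s then k a u else 0.
    have [T hT [hs hd]] := hseq _ (filter_uniq (fun a => I a != arcs G a) (enum_uniq 'I_(n - 3))).
    by exists T => //; split=> // u a; rewrite hd mem_filter mem_enum andbT.
  elim: s => [_|b s IH /= /andP[bs /IH[T hT [hs hd]]]].
    by exists id; [exact: rho_pl_id | split=> // u a; rewrite addr0].
  have inv u c : same_sides rho (u + c *: delta_mx 0 (rshift n.-1 b)) u.
    by move=> i; exact: u_side_diag_shift.
  exists (shear (rshift n.-1 b) (k b) \o T); last split.
  - apply: rho_pl_comp => //; apply: rho_pl_shear_form; apply: rho_form_affine.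
      by move=> u c; exact: kE.
    move=> S rS; apply: affine_formB; last exact: affine_form_cst.
    by apply: affine_form_sum => i; exact: affine_form_u_side.
  - by move=> u; apply: same_sides_trans (hs u); exact: inv.
  move=> u a; rewrite /= /shear u_diag_diag_shift hd inE (kE b _ u (hs u)).
  have [->|ab] := eqVneq a b; first by rewrite (negbTE bs) mul1r addr0.
  by rewrite mul0r addr0.
exists T => // u.
have hl e : len rho (arcs G) (T u) e = len rho I u e.
  case: e => [i|a] /=; first by rewrite hs.
  rewrite hd (eq_bigr (fun i => u_side rho u i)); last by move=> i _; exact: hs.
  case: eqP => [->|]; first by rewrite addr0.
  case: (hI a) => -> // _; rewrite /k.
  have := sum_u_side u; rewrite (bigID (mem (arcs G a))) /=.
  rewrite [X in _ + X = _](eq_bigl (mem (~: arcs G a)%SET)); last by move=> i; rewrite !inE.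
  by rewrite /arcs /= => h; lra.
by rewrite /Delta /=; split=> h a b c habc; have := h a b c habc; rewrite !hl.
Qed.

End Normalisation.

(** * Renumbering the diagonals *)

Section Relabelling.
Variables (n : nat) (R : realType) (rho : R).
Implicit Types (s : {perm 'I_(n - 3)}) (u : 'rV[R]_(n.-1 + (n - 3))).

Definition lift_diag_perm_fun s (k : 'I_(n.-1 + (n - 3))) : 'I_(n.-1 + (n - 3)) :=
  match fintype.split k with inl j => lshift (n - 3) j | inr a => rshift n.-1 (s a) end.

Lemma lift_diag_perm_inj s : injective (lift_diag_perm_fun s).
Proof.
rewrite /lift_diag_perm_fun => k k'.
case: (fintype.splitP k) => [j h|j h]; case: (fintype.splitP k') => [j' h'|j' h'] /=.
- by move=> /lshift_inj e; apply: val_inj; rewrite /= h h' e.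
- by move=> /eqP; rewrite eq_lrshift.
- by move=> /eqP; rewrite eq_rlshift.
- by move=> /rshift_inj/perm_inj e; apply: val_inj; rewrite /= h h' e.
Qed.

Definition relabel s : 'rV[R]_(n.-1 + (n - 3)) -> 'rV[R]_(n.-1 + (n - 3)) :=
  col_perm (perm (@lift_diag_perm_inj s)).

Lemma u_diag_relabel s u a : u_diag (relabel s u) a = u_diag u (s a).
Proof.
rewrite /u_diag /relabel mxE permE /lift_diag_perm_fun.
by have -> : rshift n.-1 a = unsplit (inr a) by []; rewrite unsplitK.
Qed.

Lemma same_sides_relabel s u : same_sides rho (relabel s u) u.
Proof.
apply: eq_u_side => j; rewrite /relabel mxE permE /lift_diag_perm_fun.
by have -> : lshift (n - 3) j = unsplit (inl j) by []; rewrite unsplitK.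
Qed.

Lemma enum_perm (T : finType) (L L' : seq T) : uniq L -> uniq L' ->
  (forall a, a \in L) -> (forall a, a \in L') -> exists p : {perm T}, map p L = L'.
Proof.
move=> uL uL' aL aL'.
have sz : size L = size L'.
  by apply: perm_size; apply: uniq_perm => // a; rewrite aL aL'.
pose f a := nth a L' (index a L).
have lt a : (index a L < size L')%N by rewrite -sz index_mem.
have finj : injective f.
  move=> a b; rewrite /f (set_nth_default a) // => /eqP.
  by rewrite nth_uniq // => /eqP e; rewrite -(nth_index a (aL a)) e nth_index.
exists (perm finj); case EL: {1}L => [|a0 L0].
  by apply/esym/size0nil; rewrite -sz EL.
rewrite -EL; apply: (@eq_from_nth _ a0); first by rewrite size_map sz.
move=> k; rewrite size_map => kL.
rewrite (nth_map a0) // permE /f index_uniq //; apply: set_nth_default.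
by rewrite -sz.
Qed.

Lemma top_comb (x : edge n) i zs z : top (comb x i zs z) = x.
Proof. by case: zs => [|[]]. Qed.

Lemma mem_inner_comb (x : edge n) i zs z a :
  (inr a \in inner (comb x i zs z)) = (a \in map fst zs).
Proof.
by elim: zs x i => //= -[b j] zs IH x i; rewrite !inE top_comb IH.
Qed.

Lemma uniq_inner_comb (x : edge n) i zs z :
  uniq (inner (comb x i zs z)) -> uniq (map fst zs).
Proof.
elim: zs x i => //= -[b j] zs IH x i /= /andP[_]; rewrite top_comb => /andP[h /IH ->].
by rewrite -(mem_inner_comb (inr b) j zs z b) h.
Qed.

(** Equal leaves leave only the spines to compare, and each spine lists every diagonal exactly once,
    so a permutation of indices carries one to the other. *)
Lemma comb_relabel (x : edge n) (k : 'I_n) i zs z i' zs' z' : x = inl k ->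
  (forall a, inr a \in inner (comb x i zs z)) ->
  (forall a, inr a \in inner (comb x i' zs' z')) ->
  uniq (inner (comb x i zs z)) -> uniq (inner (comb x i' zs' z')) ->
  leaves (comb x i zs z) = leaves (comb x i' zs' z') ->
  exists s, forall u, feasible rho (comb x i zs z) (relabel s u) <->
                      feasible rho (comb x i' zs' z') u.
Proof.
move=> xk a1 a2 /uniq_inner_comb u1 /uniq_inner_comb u2.
rewrite !leaves_comb => -[<- /rcons_inj[hs <-]].
have [||s hss] := enum_perm u1 u2.
- by move=> a; rewrite -(mem_inner_comb x i zs z).
- by move=> a; rewrite -(mem_inner_comb x i' zs' z').
have -> : zs' = [seq (s c.1, c.2) | c <- zs].
  elim: zs zs' hs hss {a1 a2 u1 u2} => [|[a j] zs IH] [|[a' j'] zs'] //=.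
  by move=> [<- h1] [<- h2]; rewrite -(IH _ h1 h2).
exists s => u; apply: iff_sym; apply: feasible_comb_relabel.
- by move=> j; symmetry; exact: same_sides_relabel.
- by move=> a _; rewrite u_diag_relabel.
- by move=> w; rewrite xk /= (same_sides_relabel s u).
Qed.

Lemma rho_pl_relabel s : rho_pl rho (relabel s).
Proof. exact: rho_pl_perm. Qed.

End Relabelling.

(** * Comparison of two triangulations *)

Section TreeComparison.
Variables (n : nat) (R : realType) (rho : R).
Hypothesis n_ge3 : (3 <= n)%N.

Lemma triangulation_comb (G : triangulation n) t : triangulation_tree G n_ge3 t ->
  exists i zs z, let c := comb (inl (closing_side n_ge3)) i zs z in
    [/\ flip_equiv rho t c, map val (leaves c) = iota 0 n.-1, uniq (inner c) &
        forall a, inr a \in inner c].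
Proof.
move=> [l [r [tE ht dl dr]]]; have n1 : (n.-1 < n)%N by lia.
have ut := uniq_labels n_ge3 ht n1.
have ix := @integral_edge_closing n R rho n_ge3 G t ht.
have Lt := leaves_spans n_ge3 ht.
have ct a : inr a \in labels t.
  apply: (labels_complete n_ge3 ht n1) => //=.
  by have := ltn_ord (diag G a).2; lia.
rewrite tE in ut ix Lt ct *; have [i [zs [z h]]] := flip_equiv_comb dl dr ut ix.
exists i, zs, z; have [h1 h2 h3 _] := h; split=> //.
- by rewrite h1 Lt subn0.
- by rewrite (perm_uniq h3); have /andP[] := ut.
by move=> a; rewrite (perm_mem h3); have := ct a; rewrite inE.
Qed.

Lemma Delta_equiv (G G' : triangulation n) I I' : side_choice G I -> side_choice G' I' ->
  exists2 T, rho_pl rho T & forall u, Delta rho G I (T u) <-> Delta rho G' I' u.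
Proof.
move=> hI hI'.
have [t ht] := triangulation_tree_exists G n_ge3.
have [t' ht'] := triangulation_tree_exists G' n_ge3.
have [i [zs [z [e1 l1 u1 c1]]]] := triangulation_comb ht.
have [i' [zs' [z' [e2 l2 u2 c2]]]] := triangulation_comb ht'.
have ll := inj_map val_inj (etrans l1 (esym l2)).
have [s hs] := comb_relabel rho (erefl _) c1 c2 u1 u2 ll.
have inv (T : 'rV[R]_(n.-1 + (n - 3)) -> 'rV[R]_(n.-1 + (n - 3)))
    (X Y : 'rV[R]_(n.-1 + (n - 3)) -> Prop) :
    rho_pl rho T -> (forall u, Y (T u) <-> X u) ->
    exists2 U, rho_pl rho U & forall u, X (U u) <-> Y u.
  move=> [U hU] hT; exists U; first by exists T; exact: pl_automorphism_with_sym.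
  by move=> u; rewrite -hT; have [_ -> _ _ _] := hU.
have [_ _ _ [T1 g1 h1]] := e1; have [_ _ _ [T2 g2 h2]] := e2.
have [|U1 k1 f1] := inv T1 (feasible rho t)
  (feasible rho (comb (inl (closing_side n_ge3)) i zs z)) g1.
  by move=> u; case: (h1 u).
have {}h2 u : feasible rho (comb (inl (closing_side n_ge3)) i' zs' z') (T2 u) <->
    feasible rho t' u by case: (h2 u).
have [N1 n1 m1] := @Delta_arcs n R rho n_ge3 G I hI.
have [N2 n2 m2] := @Delta_arcs n R rho n_ge3 G' I' hI'.
have [M1 p1 q1] := inv N1 (Delta rho G I) (Delta rho G (arcs G)) n1 m1.
have [l [r [_ st _ _]]] := ht; have [l' [r' [_ st' _ _]]] := ht'.
(* From right to left: normalise [I'], straighten the tree of [G'] to a comb, renumber, undo the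
   straightening for [G], undo the normalisation of [I]. *)
exists (M1 \o (U1 \o (relabel s \o (T2 \o N2)))).
  apply: rho_pl_comp p1; apply: rho_pl_comp k1; apply: rho_pl_comp (rho_pl_relabel _ s).
  exact: rho_pl_comp n2 g2.
move=> u /=; rewrite q1 (Delta_feasible n_ge3 rho _ st) f1 hs h2.
by rewrite -(Delta_feasible n_ge3 rho _ st') m2.
Qed.

End TreeComparison.

(** * A vertex with coordinate rho *)

Section IntegralVertex.
Variables (n : nat) (G : triangulation n).
Hypothesis n_ge3 : (3 <= n)%N.
Implicit Types (t l r : tree n) (e f g : edge n).

(** Descending into a child that is not a leaf must end at a node with two leaves; this ear avoids
    the closing side as one of its two sides. *)
Lemma in_triangles_ear t i j : spans G t i j -> (j < n)%N -> (i.+1 < j)%N ->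
  exists k e f g, [/\ (i <= k)%N, (k + 2 <= j)%N, in_triangles t e f g &
    [/\ span G e = (k, k.+2), span G f = (k, k.+1) & span G g = (k.+1, k.+2)]].
Proof.
elim: t i j => [k i j [_ ->]|a l IHl r IHr i j [ha [w [hl hr]]]]; first by lia.
move=> jn ij.
have iw := spans_lt n_ge3 hl; have wj := spans_lt n_ge3 hr; have wn := ltn_trans wj jn.
have [wi|wi] := eqVneq w i.+1; last first.
  have [|k [e [f [g [h1 h2 h3 h4]]]]] := IHl _ _ hl wn; first by lia.
  by exists k, e, f, g; split=> //; [lia | apply: Or32].
have [jw|jw] := eqVneq j w.+1; last first.
  have [|k [e [f [g [h1 h2 h3 h4]]]]] := IHr _ _ hr jn; first by lia.
  by exists k, e, f, g; split=> //; [lia | apply: Or33].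
exists i, a, (top l), (top r); split; [lia|lia|by apply: Or31|].
by rewrite (spans_top n_ge3 wn hl) (spans_top n_ge3 jn hr) ha jw wi.
Qed.

Lemma in_triangles_cover t i j e : spans G t i j -> (i.+1 < j)%N -> e \in labels t ->
  exists a b c, in_triangles t a b c /\ [\/ e = a, e = b | e = c].
Proof.
elim: t i j => [k i j [_ ->]|a l IHl r IHr i j [ha [w [hl hr]]]]; first by lia.
move=> ij.
have -> : labels (Node a l r) = a :: labels l ++ labels r by [].
have sub t' i' j' : spans G t' i' j' -> e \in labels t' ->
    e = top t' \/ (i'.+1 < j')%N.
  move=> ht; have := spans_lt n_ge3 ht; case: t' ht => [k|x l' r'] ht ij'.
    by rewrite inE => /eqP->; left.
  right; have [_ [w' [hl' hr']]] := ht.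
  by have := spans_lt n_ge3 hl'; have := spans_lt n_ge3 hr'; lia.
rewrite inE mem_cat => /or3P[/eqP->|he|he].
- by exists a, (top l), (top r); split; [apply: Or31 | apply: Or31].
- have [->|iw] := sub _ _ _ hl he.
    by exists a, (top l), (top r); split; [apply: Or31 | apply: Or32].
  have [a' [b' [c' [h1 h2]]]] := IHl _ _ hl iw he.
  by exists a', b', c'; split=> //; apply: Or32.
have [->|iw] := sub _ _ _ hr he.
  by exists a, (top l), (top r); split; [apply: Or31 | apply: Or33].
have [a' [b' [c' [h1 h2]]]] := IHr _ _ hr iw he.
by exists a', b', c'; split=> //; apply: Or33.
Qed.

Variables (R : realType) (rho : R).
Implicit Types (u : 'rV[R]_(n.-1 + (n - 3))).

(** Every edge lies in a triangle, whose inequalities bound its length below by a difference and by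
    the opposite difference. *)
Lemma len_ge0 I u e : Delta rho G I u -> 0 <= len rho I u e.
Proof.
have n1 : (n.-1 < n)%N by lia.
have [t [l [r [_ ht _ _]]]] := triangulation_tree_exists G n_ge3.
move=> /(Delta_triangles n_ge3 rho I u ht) h.
have [||a [b [c [habc he]]]] := @in_triangles_cover t 0 n.-1 e ht; first by lia.
  apply: (labels_complete n_ge3 ht n1) => //.
  by have := span_lt G n_ge3 e; lia.
have := h _ _ _ habc; rewrite triangle_ineqP => -[h1 h2 h3].
by case: he => ->; lra.
Qed.

(** Real coefficients accommodate the factor 1/2 and suffice for the functional that exposes a
    vertex. *)
Lemma affine_form_len I e : affine_form (@whole_ring R) (fun u => len rho I u e).
Proof.
have half (F : 'rV[R]_(n.-1 + (n - 3)) -> R) : affine_form (@whole_ring R) F ->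
    affine_form (@whole_ring R) (fun u => 2^-1 * F u).
  move=> [c [d [_ _ FE]]]; exists (2^-1 *: c), (2^-1 * d); split=> //.
    exact/mxOverP.
  by move=> u; rewrite FE -scalemxAr [in RHS]mxE mulrDr.
case: e => [i|a] /=; first by apply: half; apply: affine_form_u_side.
apply: affine_formD; first by apply: affine_formN; exact: affine_form_u_diag.
by apply: half; apply: affine_form_sum => i; apply: affine_form_u_side.
Qed.

Lemma len_inj I u v : (forall e, len rho I u e = len rho I v e) -> u = v.
Proof.
move=> h; have hs i : u_side rho u i = u_side rho v i.
  by have /= := h (inl i) => /mulfI; apply; rewrite invr_neq0.
apply/rowP => k; rewrite -[k]splitK; case: (fintype.split k) => [j|a] /=.
  have jn : (j < n)%N by have := ltn_ord j; lia.
  have := hs (Ordinal jn); rewrite !(@u_side_indep _ _ _ _ _ j) //.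
have /= := h (inr a); rewrite (eq_bigr (fun i => u_side rho v i)); last by move=> i _; exact: hs.
by move=> /addIr /oppr_inj.
Qed.

(* The vertex at which an ear has its two sides of length rho / 2 and every
   other edge is degenerate. *)
Lemma ear_vertex I : 0 < rho -> exists2 v, vertex (Delta rho G I) v &
  exists j, v 0 (lshift (n - 3) j) = rho.
Proof.
move=> rho0; have n1 : (n.-1 < n)%N by lia.
have [t [l [r [_ ht _ _]]]] := triangulation_tree_exists G n_ge3.
have [|k [e0 [f [g [_ kn he0 [se sf sg]]]]]] := in_triangles_ear ht n1; first by lia.
(* The only edges at the tip k + 1 of the ear are its two sides. *)
pose lam e := if ((span G e).1 == k.+1) || ((span G e).2 == k.+1) then 2^-1 * rho else 0.
have lam0 e : e != f -> e != g -> lam e = 0.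
  move=> ef eg; rewrite /lam; case: ifP => // /orP[]/eqP h.
    have := span_nested G n_ge3 e0 e; rewrite se h /= => h1.
    have := span_lt G n_ge3 e; move: eg; rewrite -(inj_eq (@span_inj n G n_ge3)) sg.
    by rewrite [span G e]surjective_pairing xpair_eqE h eqxx /=; lia.
  have := span_nested G n_ge3 e e0; rewrite se h /= => h1.
  have := span_lt G n_ge3 e; move: ef; rewrite -(inj_eq (@span_inj n G n_ge3)) sf.
  by rewrite [span G e]surjective_pairing xpair_eqE h eqxx andbT /=; lia.
pose sd := \row_(j < n.-1) (2 * lam (inl (widen_ord (ltnW n1) j))).
(* Side values ignore diagonal coordinates, so [v0] supplies those needed to solve for the diagonal
   coordinates of [v]. *)
pose v0 := row_mx sd (0 : 'rV[R]_(n - 3)).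
pose v := row_mx sd (\row_a (2^-1 * \sum_(i in I a) u_side rho v0 i - lam (inr a))).
have vl j : v 0 (lshift (n - 3) j) = 2 * lam (inl (widen_ord (ltnW n1) j)).
  by rewrite /v row_mxEl mxE.
have lamE (j : 'I_n.-1) : 2 * lam (inl (widen_ord (ltnW n1) j)) =
    (j == k :> nat)%:R * rho + (j == k.+1 :> nat)%:R * rho.
  have jn : (nat_of_ord j == n.-1) = false by apply/eqP; have := ltn_ord j; lia.
  rewrite /lam /= jn /= eqSS; have [jk|] := eqVneq (nat_of_ord j) k.+1.
    rewrite (_ : (nat_of_ord j == k) = false) /=; first by rewrite mul0r mul1r; lra.
    by apply/eqP; lia.
  by move=> _; case: eqVneq => _ /=; rewrite ?mul1r ?mul0r; lra.
have lam_closing (i : 'I_n) : i = n.-1 :> nat -> lam (inl i) = 0.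
  by move=> h; apply: lam0; apply/eqP => /(congr1 (span G)); rewrite ?sf ?sg /= h eqxx => -[]; lia.
have sv i : u_side rho v i = 2 * lam (inl i).
  have [ilt|ige] := ltnP i n.-1.
    by rewrite (@u_side_indep _ _ _ v i (Ordinal ilt)) // vl.
  have iE : i = n.-1 :> nat by have := ltn_ord i; lia.
  rewrite (u_side_closing _ _ iE) lam_closing // mulr0.
  rewrite (eq_bigr _ (fun j _ => vl j)) (eq_bigr _ (fun j _ => lamE j)) big_split /=.
  have one m : (m < n.-1)%N -> \sum_(j < n.-1) (j == m :> nat)%:R * rho = rho.
    move=> mn; rewrite (bigD1 (Ordinal mn)) //= eqxx mul1r big1 ?addr0 // => j.
    by rewrite -val_eqE /= => /negbTE ->; rewrite mul0r.
  by rewrite !one; [lra | lia | lia].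
have sv0 i : u_side rho v0 i = u_side rho v i.
  by apply: eq_u_side => j; rewrite /v /v0 !row_mxEl.
have lenv e : len rho I v e = lam e.
  case: e => [i|a] /=; first by rewrite sv; lra.
  rewrite /u_diag {1}/v row_mxEr mxE (eq_bigr _ (fun i _ => sv0 i)); lra.
have dv : Delta rho G I v.
  apply/(Delta_triangles n_ge3 rho I v ht) => a b c /(in_triangles_span n_ge3 ht n1).
  move=> [x [y [z [xy yz [ha hb hc]]]]]; rewrite !lenv triangle_ineqP /lam ha hb hc /=.
  (* At most one vertex of a triangle is the tip, so its lengths are all 0, or twice rho / 2 and
     once 0. *)
  by case: eqP => [?|?]; case: eqP => [?|?]; case: eqP => [?|?] /=; split; (lia || lra).
(* On the polytope [L] is nonnegative. Where it vanishes, the base of the ear has length 0, so the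
   two ear sides are equal, and the perimeter 2 rho makes each rho / 2; thus [- L] is maximal at [v]
   only. *)
pose L u := \sum_(e | (e != f) && (e != g)) len rho I u e.
have Lv : L v = 0 by apply: big1 => e /andP[ef eg]; rewrite lenv lam0.
have [c [d [_ _ LE]]] : affine_form (@whole_ring R) (fun u => - L u).
  by apply: affine_formN; apply: affine_form_sum => e; exact: affine_form_len.
exists v.
  split=> //; exists c => u du uv; have Lu0 e : 0 <= len rho I u e := len_ge0 e du.
  suff : 0 < L u by have := LE u; have := LE v; rewrite Lv; lra.
  rewrite lt_def sumr_ge0 ?andbT; last by move=> e _; exact: Lu0.
  apply: contra uv => /eqP Lu.
  have lu e : e != f -> e != g -> len rho I u e = 0.
    move=> ef eg; apply/eqP; rewrite eq_le Lu0 andbT -Lu /L (bigD1 e) ?ef //=.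
    by rewrite lerDl sumr_ge0.
  apply/eqP/(@len_inj I) => e; rewrite lenv.
  have /triangle_ineqP[t1 t2 t3] : triangle_ineq (len rho I u e0) (len rho I u f) (len rho I u g).
    exact: (proj1 (Delta_triangles n_ge3 rho I u ht)) du _ _ _ he0.
  have e0f : e0 != f by apply/eqP => /(congr1 (span G)); rewrite se sf => -[]; lia.
  have e0g : e0 != g by apply/eqP => /(congr1 (span G)); rewrite se sg => -[]; lia.
  rewrite (lu e0) // in t1 t2 t3.
  have kn' : (k < n)%N by lia.
  have kn'' : (k.+1 < n)%N by lia.
  have fE : f = inl (Ordinal kn').
    apply: (@span_inj n G n_ge3); rewrite sf /=; case: eqP => // h; lia.
  have gE : g = inl (Ordinal kn'').
    apply: (@span_inj n G n_ge3); rewrite sg /=; case: eqP => // h; lia.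
  have lfg : len rho I u f + len rho I u g = rho.
    have := sum_u_side rho n_ge3 u.
    rewrite (bigD1 (Ordinal kn')) //= (bigD1 (Ordinal kn'')) /=; last first.
      by rewrite -val_eqE /=; lia.
    rewrite big1 => [|i /andP[i1 i2]]; first by rewrite fE gE /= => h; lra.
    have /= : len rho I u (inl i) = 0 by apply: lu; rewrite ?fE ?gE.
    by move=> /eqP; rewrite mulf_eq0 invr_eq0 pnatr_eq0 /= => /eqP.
  have [->|ef] := eqVneq e f; first by rewrite /lam sf /= eqxx orbT; lra.
  have [->|eg] := eqVneq e g; first by rewrite /lam sg /= eqxx /=; lra.
  by rewrite lu // lam0.
have kn1 : (k < n.-1)%N by lia.
exists (Ordinal kn1); rewrite vl lamE /= eqxx mul1r (_ : (k == k.+1) = false) ?mul0r ?addr0 //.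
by apply/eqP; lia.
Qed.

End IntegralVertex.

Theorem theorem1p4 (R : realType) (n : nat) (hn : (3 <= n)%N)
    (r : 'I_n -> R) (r_gt0 : forall i, 0 < r i)
    (r_lt : forall i, r i < \sum_(j < n | j != i) r j)
    (G G' : triangulation n) (I I' : 'I_(n - 3) -> {set 'I_n})
    (hI : side_choice G I) (hI' : side_choice G' I') :
  exists T : 'rV[R]_(n.-1 + (n - 3)) -> 'rV[R]_(n.-1 + (n - 3)),
    [/\ pl_automorphism T,
        (T @` Delta (\sum_i r i) G' I')%classic = Delta (\sum_i r i) G I &
        integral_polytope (Delta (\sum_i r i) G I) -> defined_over_Z T].
Proof.
have rho0 : 0 < \sum_i r i.
  have i0 : 'I_n by exists 0%N; lia.
  rewrite (bigD1 i0) //=; apply: ltr_pwDl; first exact: r_gt0.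
  by apply: sumr_ge0 => i _; exact: ltW.
have [T [T' [c1 c2 k1 k2 hpl]] hT] := Delta_equiv (\sum_i r i) hn hI hI'.
exists T; split.
- exists T'; split=> //; split=> //.
    by have [] := hpl (@whole_ring R) isT.
  by have [] := hpl (@whole_ring R) isT.
- apply/seteqP; split=> [_ [u hu <-]|u hu]; first exact/hT.
  by exists (T' u); [apply/hT; rewrite c2 | exact: c2].
move=> hint; have [v /hint /mxOverP hv [j hj]] := ear_vertex G hn I rho0.
(* Once rho is an integer, [Num.int] is one of the subrings over which [T] is already known to be
   piecewise affine. *)
have rint : \sum_i r i \in (Num.int : {pred R}) by rewrite -hj; exact: hv.
by have [] := hpl _ rint.
Qed.
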